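(* Let $X\sim\mathcal N(\mu,\sigma^2)$ on $\mathcal X=\mathbb R$ with $\sigma>0$, and take the squared distortion $\Delta(x,\hat x)=(x-\hat x)^2$. Define $$\phi(D):=\inf_{p_{\hat X|X}}\{I(X;\hat X):\mathbb E[(X-\hat X)^2]\le D,\ p_{\hat X}=p_X\}.$$ Define $\varphi(D)$ as the infimum of $\max\{I(X;U),I(\hat X;U)\}$ over Polish spaces $\mathcal U$ and kernels $p_{U\hat X|X}$ with $\hat X\in\mathbb R$, subject to: - $\mathbb E[(X-\hat X)^2]\le D$; - $X\leftrightarrow U\leftrightarrow\hat X$ is a Markov chain; - $p_{\hat X}=p_X$. Then for $D\in[0,2\sigma^2)$, $$\phi(D)=\tfrac12\log\frac{4\sigma^4}{4\sigma^2D-D^2}\qquad\text{and}\qquad\varphi(D)=\tfrac12\log\frac{2\sigma^2}{D},$$ both interpreted as $+\infty$ at $D=0$. For $D\ge2\sigma^2$, $\phi(D)=\varphi(D)=0$.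
   Context: Logarithms are base 2. *)

(* Defs.v *)
From HB Require Import structures.
From mathcomp Require Import all_boot all_order all_algebra.
From mathcomp Require Import all_classical all_reals.
From mathcomp Require Import ereal topology normedtype sequences exp measure
  lebesgue_measure lebesgue_integral kernel probability normal_distribution.
Set Implicit Arguments. Unset Strict Implicit. Unset Printing Implicit Defensive.
Import Order.TTheory GRing.Theory Num.Theory.
Local Open Scope classical_set_scope.
Local Open Scope ring_scope.

Section defs.
Variable R : realType.

Definition log2 (x : R) : R := ln x / ln 2.

Definition mpartition d (T : measurableType d) n (A : 'I_n -> set T) : Prop :=
  [/\ (forall i, measurable (A i)), trivIset setT A & \bigcup_i A i = setT].

Definition mi_term (p q r : R) : R := if p == 0 then 0 else p * log2 (p / (q * r)).

(* discrete mutual information of the quantization of a joint law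
   pxy (given on rectangles) along the partitions A and B *)
Definition mi_part d1 d2 (T1 : measurableType d1) (T2 : measurableType d2)
  (pxy : set T1 -> set T2 -> \bar R) n m (A : 'I_n -> set T1) (B : 'I_m -> set T2) : R :=
  \sum_(i < n) \sum_(j < m)
     mi_term (fine (pxy (A i) (B j))) (fine (pxy (A i) setT)) (fine (pxy setT (B j))).

(* Mutual information of a pair with joint law pxy (Dobrushin /
   Gelfand-Yaglom-Perez definition): supremum over finite measurable
   partitions of the discrete mutual information of the quantized pair. *)
Definition mutinfo d1 d2 (T1 : measurableType d1) (T2 : measurableType d2)
  (pxy : set T1 -> set T2 -> \bar R) : \bar R :=
  ereal_sup [set v | exists n m (A : 'I_n -> set T1) (B : 'I_m -> set T2),
     [/\ mpartition A, mpartition B & v = (mi_part pxy A B)%:E]].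

Section phi.
Variables (mu sigma : R).
Let P := normal_prob mu sigma.

Definition joint_XXh (k : R.-pker R ~> R) (A : set R) (C : set R) : \bar R :=
  (\int[P]_(x in A) k x C)%E.

Definition phi_feasible (D : R) (k : R.-pker R ~> R) : Prop :=
  (\int[P]_x \int[k x]_y ((x - y) ^+ 2)%:E <= D%:E)%E /\
  (forall C, measurable C -> joint_XXh k setT C = P C).

Definition phi (D : R) : \bar R :=
  ereal_inf [set mutinfo (joint_XXh k) | k in phi_feasible D].
End phi.

Definition borelU (U : completePseudoMetricType R) := g_sigma_algebraType (@open U).

(* Polish: complete (pseudo)metric, Hausdorff (so metric), separable *)
Definition polish (U : completePseudoMetricType R) : Prop :=
  hausdorff_space U /\ exists S : set U, countable S /\ closure S = setT.

Section varphi.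
Variables (mu sigma : R).
Let P := normal_prob mu sigma.
Variable (U : completePseudoMetricType R).

(* Markov chain X -> U -> Xhat : X ~ P, U | X ~ k1, Xhat | U ~ k2 *)
Definition joint_XU (k1 : R.-pker R ~> borelU U) (A : set R) (B : set (borelU U))
  : \bar R := (\int[P]_(x in A) k1 x B)%E.

Definition joint_XhU (k1 : R.-pker R ~> borelU U) (k2 : R.-pker borelU U ~> R)
  (C : set R) (B : set (borelU U)) : \bar R :=
  (\int[P]_x \int[k1 x]_(u in B) k2 u C)%E.

Definition varphi_feasible (D : R) (k1 : R.-pker R ~> borelU U)
  (k2 : R.-pker borelU U ~> R) : Prop :=
  (\int[P]_x \int[k1 x]_u \int[k2 u]_y ((x - y) ^+ 2)%:E <= D%:E)%E /\
  (forall C, measurable C -> joint_XhU k1 k2 C setT = P C).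

Definition varphi_value (k1 : R.-pker R ~> borelU U) (k2 : R.-pker borelU U ~> R)
  : \bar R := Order.max (mutinfo (joint_XU k1)) (mutinfo (joint_XhU k1 k2)).
End varphi.

Definition varphi (mu sigma D : R) : \bar R :=
  ereal_inf [set v | exists (U : completePseudoMetricType R)
     (k1 : R.-pker R ~> borelU U) (k2 : R.-pker borelU U ~> R),
     [/\ polish U, varphi_feasible mu sigma D k1 k2 & v = varphi_value mu sigma k1 k2]].

End defs.

(* Main.v *)
Require Import Defs.
From HB Require Import structures.
From mathcomp Require Import all_boot all_order all_algebra.
From mathcomp Require Import all_classical all_reals.
From mathcomp Require Import ereal topology normedtype sequences exp measure
  lebesgue_measure lebesgue_integral kernel probability normal_distribution.
From mathcomp Require Import numfun measurable_realfun giry ring lra.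
Import Order.TTheory GRing.Theory Num.Theory numFieldNormedType.Exports.
Set Implicit Arguments.
Unset Strict Implicit.
Unset Printing Implicit Defensive.
Local Open Scope ring_scope.
Local Open Scope classical_set_scope.

(** Lower bounds. If [X ~ N(mu, s^2)] and some function [v] of [Z] satisfies
    [E (X - v Z)^2 <= del^2], then [I(X;Z) >= log (s / del)]: this is the
    Donsker-Varadhan inequality for the density of the backward Gaussian test
    channel, evaluated on finer and finer quantizations of [X] and [v Z]. For
    [phi] one takes [v y = mu + rho (y - mu)] with [rho = 1 - D / (2 s^2)]. For
    [varphi] one takes the conditional mean [W] of the reconstruction given [U];
    since [E (X - Y)^2 = E (X - W)^2 + E (Y - W)^2], one of the two terms is at
    most [D / 2], so that one of [I(X;U)], [I(Y;U)] is at least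
    [log (s / sqrt (D / 2))].

    Upper bounds. The Gaussian channel of correlation [r] is reversible for
    [N(mu, s^2)]. Used once with [r = rho] it attains [phi]; used twice, as
    encoder and as decoder, with [r = sqrt rho] it attains [varphi]. Its mutual
    information is at most the mean of its log-density, again by [ln t <= t - 1]. *)

(** * Semidirect products and quantization *)

(** Mutual information is here a supremum over finite partitions, so the test function of the lower
    bound must be finite-valued, and it is refined in two stages. While [v] is finite-valued only
    [X] is refined: the normalization term is then a finite sum of Gaussian integrals, each with
    limit 1. Afterwards [v] is refined, and only the quadratic error has to pass to the limit.

    The factor [rho] is the correlation of source and reconstruction when both variances are [s^2]
    and the distortion is exactly [D], that is [D = 2 s^2 (1 - rho)]. Hence [rho (y - mu)] is the
    linear regression of [X - mu], with error [s^2 (1 - rho^2)]; this is where the constraint on the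
    output law brings the error below [D]. Along a chain of two Gaussian channels the correlations
    multiply, whence [sqrt rho] for each half. For [varphi] the same constraint lets the
    reconstruction act as a second Gaussian source. At [D = 0] the lower bound is available for
    every small [del], and its values are unbounded. *)

Section kernel_product.
Context d1 d2 (T1 : measurableType d1) (T2 : measurableType d2) (R : realType).

Section pointwise.
Variables (k : R.-pker T1 ~> T2) (x : T1).
(** A name for [k x] that can carry the probability structure required by the Giry monad
    operations. *)
Definition kernel_at : set T2 -> \bar R := k x.
HB.instance Definition _ := Measure.on kernel_at.
HB.instance Definition _ :=
  @Measure_isProbability.Build _ _ R kernel_at (prob_kernel x).
End pointwise.

Variables (P : probability T1 R) (k : R.-pker T1 ~> T2).

(** The law of [(x, Y)] with [Y] drawn from [k x]; mixing these laws over [P] gives the semidirect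
    product. *)
Let graph_measure (x : T1) : giry (T1 * T2)%type R :=
  giry_map (pair1_measurable x) (kernel_at k x).

Let measurable_graph_measure : measurable_fun setT graph_measure.
Proof.
apply: measurable_giry_codensity => // B mB.
rewrite [X in measurable_fun _ X](_ : _ = kfcomp k (EFin \o \1_B)).
  apply: measurable_kfcomp => //; last by move=> t; rewrite lee_fin.
  exact/measurable_EFinP/measurable_indic.
rewrite kfcompkindic//; apply/funext => x /=.
by rewrite /graph_measure /giry_map /= /pushforward /kernel_at xsectionE.
Qed.

Definition kernel_prod : set (T1 * T2) -> \bar R :=
  giry_bind P measurable_graph_measure.

HB.instance Definition _ := Measure.on kernel_prod.

Lemma integral_kernel_prod (f : T1 * T2 -> \bar R) :
  measurable_fun setT f -> (forall x, 0 <= f x)%E ->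
  (\int[kernel_prod]_z f z = \int[P]_x \int[k x]_y f (x, y))%E.
Proof.
move=> mf f0; have := giry_int_bind P measurable_graph_measure mf f0.
rewrite /giry_int => ->; apply: eq_integral => x _.
exact: (giry_int_map (pair1_measurable x) (kernel_at k x) mf f0).
Qed.

Let kernel_prodT : kernel_prod setT = 1%E.
Proof.
rewrite -[LHS]mul1e -(integral_cst kernel_prod) // integral_kernel_prod //.
rewrite (eq_integral (cst 1%E)) ?integral_cst ?mul1e //;
  first exact: (@probability_setT _ _ _ P).
by move=> x _; rewrite integral_cst// mul1e prob_kernel.
Qed.

HB.instance Definition _ :=
  @Measure_isProbability.Build _ _ R kernel_prod kernel_prodT.

Lemma kernel_prod_rectangle (A : set T1) (B : set T2) :
  measurable A -> measurable B ->
  (kernel_prod (A `*` B) = \int[P]_(x in A) k x B)%E.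
Proof.
move=> mA mB; have mAB : measurable (A `*` B) by exact: measurableX.
rewrite -[LHS]mul1e -(integral_cst kernel_prod) // integral_mkcond.
rewrite integral_kernel_prod.
- rewrite [RHS]integral_mkcond; apply: eq_integral => x _.
  rewrite [RHS]patchE; case: ifPn => xA.
    rewrite -[RHS]mul1e -(integral_cst (k x)) // [RHS]integral_mkcond.
    apply: eq_integral => y _; rewrite !patchE in_setX /= xA /=.
    by [].
  apply: integral0_eq => y _; rewrite patchE in_setX /= (negbTE xA) /=.
  by [].
- by apply/(measurable_restrictT _ _).1 => //; exact: measurable_cst.
- by move=> z; rewrite patchE; case: ifP.
Qed.

End kernel_product.

Section finite_quantization.
Context d (T : measurableType d) (R : realType).

Definition quantized (t : T -> R) : Prop :=
  measurable_fun setT t /\ finite_set (range t).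

Lemma quantized_index (t : T -> R) : quantized t ->
  exists n (idx : T -> 'I_n) (a : 'I_n -> R),
    (forall i, measurable (idx @^-1` [set i])) /\ t =1 a \o idx.
Proof.
(* Distinct values are needed for the fiber of an index to be the whole fiber of the corresponding
   value. *)
move=> [mt /finite_seqP [s0 rs0]]; pose s := undup s0.
have ts x : t x \in s.
  by rewrite mem_undup; have : range t (t x) by []; rewrite rs0.
have lt x : (index (t x) s < size s)%N by rewrite index_mem.
exists (size s), (fun x => Ordinal (lt x)), (fun i => nth 0 s i); split.
  move=> i; rewrite [X in measurable X](_ : _ = t @^-1` [set nth 0 s i]).
    by rewrite -[X in measurable X]setTI; exact: mt.
  apply/seteqP; split=> [x /= xi|x /= fx]; first by rewrite -xi /= nth_index.
  by apply/val_inj => /=; rewrite fx index_uniq// undup_uniq.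
by move=> x /=; rewrite nth_index.
Qed.

Import HBNNSimple.

(** Positive and negative parts are approximated from below, and at each point one of them vanishes.
    This gives the bound by [|f x|], on which every later use of dominated convergence relies. *)
Lemma quantized_approximation (f : T -> R) : measurable_fun setT f ->
  exists t : nat -> T -> R,
    [/\ (forall n, quantized (t n)), (forall n x, `|t n x| <= `|f x|) &
        (forall x, t n x @[n --> \oo] --> f x)].
Proof.
move=> mf.
have mp : measurable_fun setT (EFin \o f^\+).
  by apply/measurable_EFinP; exact: measurable_funrpos.
have mn : measurable_fun setT (EFin \o f^\-).
  by apply/measurable_EFinP; exact: measurable_funrneg.
pose fp := nnsfun_approx measurableT mp.
pose fn := nnsfun_approx measurableT mn.
have cp x : fp n x @[n --> \oo] --> f^\+ x.
  have : (EFin \o (fp ^~ x)) n @[n --> \oo] --> (EFin \o f^\+) x.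
    by apply: cvg_nnsfun_approx => // y _; rewrite lee_fin.
  by move/fine_cvgP => [].
have cn x : fn n x @[n --> \oo] --> f^\- x.
  have : (EFin \o (fn ^~ x)) n @[n --> \oo] --> (EFin \o f^\-) x.
    by apply: cvg_nnsfun_approx => // y _; rewrite lee_fin.
  by move/fine_cvgP => [].
have lp n x : fp n x <= f^\+ x.
  rewrite -(cvg_lim _ (cp x))//.
  apply: (@nondecreasing_cvgn_le _ (fun n => fp n x)).
    by move=> a b ab; exact/lefP/nd_nnsfun_approx.
  by apply/cvg_ex; eexists; exact: cp.
have ln n x : fn n x <= f^\- x.
  rewrite -(cvg_lim _ (cn x))//.
  apply: (@nondecreasing_cvgn_le _ (fun n => fn n x)).
    by move=> a b ab; exact/lefP/nd_nnsfun_approx.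
  by apply/cvg_ex; eexists; exact: cn.
exists (fun n => fp n \- fn n); split.
- move=> n; split; first exact: measurable_funB.
  exact: (finite_image11 (fun a b : R => a - b) (fimfunP _) (fimfunP _)).
- move=> n x /=; have := lp n x; have := ln n x.
  have p0 : 0 <= fp n x by []. have n0 : 0 <= fn n x by [].
  rewrite /funrpos /funrneg; case: (lerP 0 (f x)) => fx.
    by rewrite max_r ?oppr_le0// ler_norml (ger0_norm fx); lra.
  have -> : Num.max (- f x) 0 = - f x by rewrite max_l// oppr_ge0 ltW.
  by rewrite ler_norml (ltr0_norm fx); lra.
- by move=> x; rewrite -(funrposBneg f); apply: cvgB.
Qed.

End finite_quantization.

Section fibers.
Context d (T : measurableType d) (R : realType).
Variables (mu : {measure set T -> \bar R}) (K : finType) (idx : T -> K).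
Hypothesis mfib : forall k, measurable (idx @^-1` [set k]).

Let fiber_decomposition (c : K -> R) (h : T -> R) :
  (fun x => (c (idx x) * h x)%:E) =
  (fun x => \sum_k ((c k)%:E * ((EFin \o h) \_ (idx @^-1` [set k])) x))%E.
Proof.
apply/funext => x; rewrite (bigD1 (idx x)) //= big1 ?adde0.
  by rewrite patchE mem_set //= EFinM.
move=> k kx; rewrite patchE memNset ?mule0 //=.
by move=> e; rewrite e eqxx in kx.
Qed.

Let integrable_fiber h k : mu.-integrable setT (EFin \o h) ->
  mu.-integrable setT ((EFin \o h) \_ (idx @^-1` [set k])).
Proof.
move=> ih; rewrite -integrable_mkcond //.
exact: (integrableS measurableT).
Qed.

Lemma integrable_fibers (c : K -> R) (h : T -> R) :
  mu.-integrable setT (EFin \o h) ->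
  mu.-integrable setT (fun x => (c (idx x) * h x)%:E).
Proof.
move=> ih; rewrite fiber_decomposition; apply: integrable_sum => //= k.
by move=> _; apply: integrableZl => //; exact: integrable_fiber.
Qed.

(** The weight [h] is the constant 1 for quantized expectations, and the reciprocal of a density in
    the upper bound on mutual information. *)
Lemma Rintegral_fibers (c : K -> R) (h : T -> R) :
  mu.-integrable setT (EFin \o h) ->
  \int[mu]_x (c (idx x) * h x) =
  \sum_k c k * \int[mu]_(x in idx @^-1` [set k]) h x.
Proof.
move=> ih; rewrite /Rintegral fiber_decomposition integral_sum //=; last first.
  by move=> k; apply: integrableZl => //; exact: integrable_fiber.
rewrite (eq_bigr (fun k =>
    (c k * \int[mu]_(x in idx @^-1` [set k]) h x)%:E)).
  by rewrite sumEFin.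
move=> k _; rewrite integralZl //; last exact: integrable_fiber.
rewrite -integral_mkcond EFinM fineK // integrable_fin_num //.
exact: (integrableS measurableT).
Qed.

End fibers.

Lemma Rintegral_finite_fibers d (T : measurableType d) (R : realType)
    (P : probability T R) (K : finType) (idx : T -> K) (c : K -> R) :
  (forall k, measurable (idx @^-1` [set k])) ->
  \int[P]_x (c (idx x)) = \sum_k c k * fine (P (idx @^-1` [set k])).
Proof.
move=> mi; have := @Rintegral_fibers _ _ _ P K idx mi c (cst 1).
under eq_Rintegral do rewrite mulr1.
move=> ->; first by apply: eq_bigr => k _; rewrite Rintegral_cst // mul1r.
exact: finite_measure_integrable_cst.
Qed.

Lemma integrable_finite_fibers d (T : measurableType d) (R : realType)
    (P : probability T R) (K : finType) (idx : T -> K) (c : K -> R) :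
  (forall k, measurable (idx @^-1` [set k])) ->
  P.-integrable setT (EFin \o (c \o idx)).
Proof.
move=> mi; have := @integrable_fibers _ _ _ P K idx mi c (cst 1).
rewrite (_ : (fun x => _) = EFin \o (c \o idx)); last first.
  by apply/funext => x; rewrite mulr1.
apply; exact: finite_measure_integrable_cst.
Qed.

Section partition_index.
Context d (T : measurableType d).

Lemma index_mpartition n (idx : T -> 'I_n) :
  (forall i, measurable (idx @^-1` [set i])) ->
  mpartition (fun i => idx @^-1` [set i]).
Proof.
move=> mi; split => //.
  by apply/trivIsetP => i j _ _ /eqP ij; apply/seteqP; split => // x /= [-> /ij].
by apply/seteqP; split => // x _; exists (idx x).
Qed.

(** Replacing partitions by index maps turns sums over cells into expectations of finite-valued
    functions. *)
Lemma mpartition_index n (A : 'I_n -> set T) : mpartition A ->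
  exists idx : T -> 'I_n, forall i, A i = idx @^-1` [set i].
Proof.
move=> [_ /trivIsetP tA cA].
have h x : exists i, A i x.
  by have : setT x by []; rewrite -cA => -[i _ Ai]; exists i.
have [idx hi] := choice h; exists idx => i; apply/seteqP; split => x /=.
  move=> Ax; apply: contrapT => /eqP ne.
  by have := tA _ _ I I ne; rewrite -subset0 => /(_ x); apply.
by move=> <-.
Qed.

End partition_index.

(** * Variational bounds on mutual information *)

Section mi_term_bounds.
Context (R : realType).
Implicit Types p q r f x : R.

Lemma ln2_gt0 : 0 < ln 2 :> R.
Proof. by rewrite ln_gt0// ltr1n. Qed.

Lemma ln_le_subr1 x : 0 < x -> ln x <= x - 1.
Proof. by move=> x0; rewrite lerBrDl -[leRHS]lnK ?posrE// expR_ge1Dx. Qed.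

Lemma mi_termE p q r :
  ln 2 * mi_term p q r = if p == 0 then 0 else p * ln (p / (q * r)).
Proof.
rewrite /mi_term /log2; case: ifP => _; first by rewrite mulr0.
by field; rewrite gt_eqF// ln2_gt0.
Qed.

(** Fenchel-Young duality between [t ln t - t] and the exponential: with [w = q r], apply
    [ln t <= t - 1] at [t = w exp f / p]. The bounds of [p] by the marginals make [w] positive as
    soon as [p] is. *)
Lemma mi_term_ge p q r f : 0 <= p -> p <= q -> p <= r ->
  p * f - q * r * expR f + p <= ln 2 * mi_term p q r.
Proof.
move=> p0 pq pr; rewrite mi_termE; case: ifPn => [/eqP p_eq0|pn0].
  rewrite p_eq0 mul0r add0r addr0 oppr_le0 mulr_ge0 ?expR_ge0 // mulr_ge0 //.
    exact: le_trans pq.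
  exact: le_trans pr.
have pgt0 : 0 < p by rewrite lt_def pn0.
have qgt0 := lt_le_trans pgt0 pq; have rgt0 := lt_le_trans pgt0 pr.
have w0 : 0 < q * r by rewrite mulr_gt0.
have e0 := expR_gt0 f.
have := ln_le_subr1 (divr_gt0 (mulr_gt0 w0 e0) pgt0).
rewrite !ln_div ?posrE ?mulr_gt0 // (lnM (x := q * r)) ?posrE // expRK => h.
have := ler_wpM2l p0 h.
have -> : p * (q * r * expR f / p - 1) = q * r * expR f - p by field.
lra.
Qed.

End mi_term_bounds.

Section mutinfo_bounds.
Context dO (Omega : measurableType dO) d1 (T1 : measurableType d1)
  d2 (T2 : measurableType d2) (R : realType).
Variables (P : probability Omega R) (X : Omega -> T1) (Z : Omega -> T2).
Hypotheses (mX : measurable_fun setT X) (mZ : measurable_fun setT Z).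
Variable J : set T1 -> set T2 -> \bar R.
Hypothesis JE : forall A B, measurable A -> measurable B ->
  J A B = P (X @^-1` A `&` Z @^-1` B).

Let mpreX A : measurable A -> measurable (X @^-1` A).
Proof. by move=> mA; rewrite -[X in measurable X]setTI; exact: mX. Qed.

Let mpreZ A : measurable A -> measurable (Z @^-1` A).
Proof. by move=> mA; rewrite -[X in measurable X]setTI; exact: mZ. Qed.

Section indexed.
Variables (n m : nat) (idx : T1 -> 'I_n) (jdx : T2 -> 'I_m).
Hypotheses (midx : forall i, measurable (idx @^-1` [set i]))
  (mjdx : forall j, measurable (jdx @^-1` [set j])).

Let cell (w : Omega) := (idx (X w), jdx (Z w)).

Let cellE k : cell @^-1` [set k] =
  X @^-1` (idx @^-1` [set k.1]) `&` Z @^-1` (jdx @^-1` [set k.2]).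
Proof.
case: k => i j; apply/seteqP; split => w /=; first by move=> [<- <-].
by rewrite /cell => -[<- <-].
Qed.

Let mcell k : measurable (cell @^-1` [set k]).
Proof. by rewrite cellE; apply: measurableI; [exact: mpreX|exact: mpreZ]. Qed.

Let p k := fine (P (cell @^-1` [set k])).
Let q i := fine (P (X @^-1` (idx @^-1` [set i]))).
Let r j := fine (P (Z @^-1` (jdx @^-1` [set j]))).

Let mi_partE : mi_part J (fun i => idx @^-1` [set i]) (fun j => jdx @^-1` [set j])
  = \sum_k mi_term (p k) (q k.1) (r k.2).
Proof.
rewrite /mi_part pair_big /=; apply: eq_bigr => -[i j] _ /=.
by rewrite !JE // !preimage_setT setIT setTI /p cellE.
Qed.

Let p_ge0 k : 0 <= p k. Proof. exact/fine_ge0. Qed.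

Let le_p_q k : p k <= q k.1.
Proof.
have mq := mpreX (midx k.1); have mp := mcell k.
rewrite fine_le ?fin_num_measure // le_measure ?inE // cellE.
exact: subIsetl.
Qed.

Let le_p_r k : p k <= r k.2.
Proof.
have mr := mpreZ (mjdx k.2); have mp := mcell k.
rewrite fine_le ?fin_num_measure // le_measure ?inE // cellE.
exact: subIsetr.
Qed.

Let sum_p : \sum_k p k = 1.
Proof.
have := Rintegral_finite_fibers P (fun=> 1) mcell; rewrite Rintegral_cst // mul1r.
have -> : fine (P setT) = 1 by rewrite probability_setT.
by under eq_bigr do rewrite mul1r.
Qed.

(* A finite-partition form of the Donsker-Varadhan lower bound, with [ln t]
   replaced by [t - 1] in the normalization term. *)
Lemma mutinfo_ge_indexed (F : 'I_n -> 'I_m -> R) (M : R) :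
  (mutinfo J <= M%:E)%E ->
  \int[P]_w F (idx (X w)) (jdx (Z w)) + 1
    - \sum_j r j * \int[P]_w expR (F (idx (X w)) j) <= ln 2 * M.
Proof.
move=> JM; have {JM} : \sum_k mi_term (p k) (q k.1) (r k.2) <= M.
  rewrite -mi_partE -lee_fin; apply: le_trans JM; apply: ereal_sup_ubound => /=.
  exists n, m, (fun i => idx @^-1` [set i]), (fun j => jdx @^-1` [set j]).
  by split => //; exact: index_mpartition.
rewrite -(ler_pM2l (ln2_gt0 R)); apply: le_trans; rewrite mulr_sumr.
have -> : \int[P]_w F (idx (X w)) (jdx (Z w)) = \sum_k F k.1 k.2 * p k.
  exact: (Rintegral_finite_fibers P (fun k => F k.1 k.2) mcell).
have -> : \sum_j r j * \int[P]_w expR (F (idx (X w)) j) =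
    \sum_k q k.1 * r k.2 * expR (F k.1 k.2).
  rewrite -(pair_bigA _ (fun i j => q i * r j * expR (F i j))) /= exchange_big /=.
  apply: eq_bigr => j _.
  rewrite (Rintegral_finite_fibers P (idx := idx \o X) (fun i => expR (F i j))).
    rewrite mulr_sumr; apply: eq_bigr => i _; rewrite -[fine (P _)]/(q i).
    ring.
  by move=> i; exact: mpreX (midx i).
rewrite -[X in _ + X - _]sum_p -big_split /= -sumrB; apply: ler_sum => k _.
have := mi_term_ge (F k.1 k.2) (p_ge0 k) (le_p_q k) (le_p_r k).
by rewrite (mulrC (p k)); lra.
Qed.

Section upper.
Variable g : Omega -> R.
Hypotheses (g_gt0 : forall w, 0 < g w)
  (int_ln : P.-integrable setT (EFin \o (fun w => ln (g w))))
  (int_inv : P.-integrable setT (EFin \o (fun w => (g w)^-1)))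
  (g_density : forall A B, measurable A -> measurable B ->
    \int[P]_(w in X @^-1` A `&` Z @^-1` B) (g w)^-1 =
    fine (P (X @^-1` A)) * fine (P (Z @^-1` B))).

(* With [lam] the likelihood ratio of the quantized laws,
   [ln lam <= ln g + lam / g - 1] and [lam / g] integrates to 1. *)
Lemma mi_part_le_indexed :
  mi_part J (fun i => idx @^-1` [set i]) (fun j => jdx @^-1` [set j])
    <= (\int[P]_w ln (g w)) / ln 2.
Proof.
rewrite ler_pdivlMr ?ln2_gt0 // mulrC mi_partE mulr_sumr.
(* The default 1 on cells of mass zero keeps [lam] positive everywhere, so that the logarithmic
   inequality holds pointwise. *)
pose lam k := if p k == 0 then 1 else p k / (q k.1 * r k.2).
have lam_gt0 k : 0 < lam k.
  rewrite /lam; case: ifPn => // pn0.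
  have p0 : 0 < p k by rewrite lt_def pn0 p_ge0.
  rewrite divr_gt0 // mulr_gt0 //.
    exact: lt_le_trans p0 (le_p_q k).
  exact: lt_le_trans p0 (le_p_r k).
have -> : \sum_k ln 2 * mi_term (p k) (q k.1) (r k.2) =
    \int[P]_w ln (lam (cell w)).
  rewrite (Rintegral_finite_fibers P (fun k => ln (lam k)) mcell); apply: eq_bigr => k _.
  rewrite mi_termE -/(p k) /lam; case: ifPn => [/eqP ->|_]; last by rewrite mulrC.
  by rewrite mulr0.
have i1 : P.-integrable setT (EFin \o (fun w => ln (lam (cell w)))).
  exact: (integrable_finite_fibers P (fun k => ln (lam k)) mcell).
have i2 : P.-integrable setT (EFin \o (fun w => lam (cell w) * (g w)^-1)).
  exact: (integrable_fibers mcell).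
have i3 : P.-integrable setT (EFin \o (cst 1 : Omega -> R)).
  exact: finite_measure_integrable_cst.
have i4 : P.-integrable setT (EFin \o (fun w => lam (cell w) * (g w)^-1 - 1)).
  by have := integrableB measurableT i2 i3.
have lamg1 : \int[P]_w (lam (cell w) * (g w)^-1) = 1.
  rewrite (Rintegral_fibers mcell) // -[RHS]sum_p; apply: eq_bigr => k _.
  rewrite cellE g_density // -/(q k.1) -/(r k.2) /lam.
  case: ifPn => [/eqP pk0|pn0].
    (* On a cell of mass zero, [g_density] turns [q * r] back into an integral over a null set, so
       the product mass vanishes too. *)
    rewrite mul1r pk0 -g_density // -cellE /Rintegral null_set_integral //.
      exact: (measurable_int P (integrableS measurableT _ _ int_inv)).
    have /eqP := pk0; rewrite /p fine_eq0 ?fin_num_measure //.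
    by move/eqP.
  have p0 : 0 < p k by rewrite lt_def pn0 p_ge0.
  have q0 := lt_le_trans p0 (le_p_q k); have r0 := lt_le_trans p0 (le_p_r k).
  by rewrite divfK // gt_eqF // mulr_gt0.
have -> : \int[P]_w ln (g w) =
    \int[P]_w (ln (g w) + (lam (cell w) * (g w)^-1 - 1)).
  rewrite RintegralD // RintegralB // lamg1 Rintegral_cst //.
  have -> : fine (P setT) = 1 by rewrite probability_setT.
  by rewrite mulr1 subrr addr0.
apply: le_Rintegral => //; first by have := integrableD measurableT int_ln i4.
move=> w _.
have := ln_le_subr1 (divr_gt0 (lam_gt0 (cell w)) (g_gt0 w)).
by rewrite ln_div ?posrE // lerBlDl.
Qed.

End upper.
End indexed.

(** Here [g] is the density of the joint law with respect to the product of its marginals. The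
    hypothesis is put on the reciprocal, the density of the product law under the joint one, so that
    every integral is taken against [P]. *)
Lemma mutinfo_le_density (g : Omega -> R) :
  (forall w, 0 < g w) ->
  P.-integrable setT (EFin \o (fun w => ln (g w))) ->
  P.-integrable setT (EFin \o (fun w => (g w)^-1)) ->
  (forall A B, measurable A -> measurable B ->
    \int[P]_(w in X @^-1` A `&` Z @^-1` B) (g w)^-1 =
    fine (P (X @^-1` A)) * fine (P (Z @^-1` B))) ->
  (mutinfo J <= ((\int[P]_w ln (g w)) / ln 2)%:E)%E.
Proof.
move=> g0 il ii gd; apply: ge_ereal_sup => _ /= [n [m [A [B [pA pB ->]]]]].
have [idx iA] := mpartition_index pA; have [jdx jB] := mpartition_index pB.
have -> : A = (fun i => idx @^-1` [set i]) by apply/funext.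
have -> : B = (fun j => jdx @^-1` [set j]) by apply/funext.
rewrite lee_fin; apply: mi_part_le_indexed => //.
  by move=> i; rewrite -iA; case: pA.
by move=> j; rewrite -jB; case: pB.
Qed.

(** The one-cell partitions already contribute the value 0. *)
Lemma mutinfo_ge0 : (0 <= mutinfo J)%E.
Proof.
apply: ereal_sup_ubound => /=.
exists 1%N, 1%N, (fun=> setT), (fun=> setT).
split.
- split => //; last by apply/seteqP; split => // x _; exists ord0.
  by apply/trivIsetP => i j _ _; rewrite !ord1 eqxx.
- split => //; last by apply/seteqP; split => // x _; exists ord0.
  by apply/trivIsetP => i j _ _; rewrite !ord1 eqxx.
rewrite /mi_part !big_ord1 JE // !preimage_setT setIT.
have -> : fine (P setT) = 1 by rewrite probability_setT.
by rewrite /mi_term oner_eq0 !mulr1 divr1 /log2 ln1 mul0r mulr0.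
Qed.

End mutinfo_bounds.

(** * Gaussian integrals *)

Section density.
Context d (T : measurableType d) (R : realType).
Variables (mu nu : {measure set T -> \bar R}) (g : T -> R).
Hypotheses (g_ge0 : forall x, 0 <= g x) (mg : measurable_fun setT g)
  (nuE : forall A, measurable A -> nu A = (\int[mu]_(x in A) (g x)%:E)%E).
Local Open Scope ereal_scope.

Import HBNNSimple.

Lemma ge0_integral_density (f : T -> \bar R) :
  measurable_fun setT f -> (forall x, 0 <= f x) ->
  \int[nu]_x f x = \int[mu]_x (f x * (g x)%:E).
Proof.
move=> mf f0; pose h := nnsfun_approx measurableT mf.
have ch x : (h n x)%:E @[n --> \oo] --> f x.
  exact: cvg_nnsfun_approx.
have mEg : measurable_fun setT (EFin \o g) by exact/measurable_EFinP.
have mh n : measurable_fun setT (EFin \o h n) by exact/measurable_EFinP.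
have ndh x : {homo (fun n => (h n x)%:E) : a b / (a <= b)%N >-> a <= b}.
  by move=> a b ab; rewrite lee_fin; exact/lefP/nd_nnsfun_approx.
transitivity (limn (fun n => \int[nu]_x (h n x)%:E)).
  rewrite -monotone_convergence //.
    by apply: eq_integral => x _; apply/esym/cvg_lim.
  by move=> n x _; rewrite lee_fin.
transitivity (limn (fun n => \int[mu]_x ((h n x)%:E * (g x)%:E))); last first.
  rewrite -monotone_convergence //.
  - apply: eq_integral => x _; apply/cvg_lim => //.
    by apply: cvgeZr => //; exact: ch.
  - move=> n; apply: emeasurable_funM => //; exact: (mh n).
  - by move=> n x _; rewrite mule_ge0 // lee_fin.
  - by move=> x _ a b ab /=; rewrite lee_wpmul2r ?lee_fin //; exact: ndh.
congr (limn _); apply/funext => n.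
rewrite integralT_nnsfun sintegralE.
under [RHS]eq_integral.
  move=> x _; rewrite fimfunE -fsumEFin // ge0_mule_fsuml; last first.
    by move=> r; rewrite EFinM nnfun_muleindic_ge0.
  over.
rewrite /= ge0_integral_fsum //; last 2 first.
- move=> r; apply: emeasurable_funM => //.
  exact/measurable_EFinP/measurable_funM.
- by move=> r x _; rewrite mule_ge0 ?lee_fin // -lee_fin EFinM nnfun_muleindic_ge0.
apply: eq_fsbigr => r rh; rewrite nuE // integral_mkcond.
have r0 : (0 <= r)%R by move: rh => /set_mem [x _ <-].
rewrite -ge0_integralZl //=.
- apply: eq_integral => x _; rewrite patchE indicE.
  by case: ifP => _; rewrite ?mulr1 ?mulr0 ?mule0 ?mul0e.
- by apply/(measurable_restrictT _ _).1 => //; exact: measurable_funTS.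
- by move=> x _; rewrite patchE; case: ifP => // _; rewrite lee_fin.
Qed.

End density.

Section normal_facts.
Context (R : realType).
Implicit Types m s x y v : R.
Notation leb := (@lebesgue_measure R).

Lemma normal_peakM s : 0 < s -> normal_peak s = s^-1 * normal_peak 1.
Proof.
move=> s0; rewrite /normal_peak expr1n mul1r -mulrnAr sqrtrM ?sqr_ge0 //.
by rewrite sqrtr_sqr gtr0_norm // invfM.
Qed.

(** The likelihood ratio of two normal laws, in the shape used throughout: its total mass yields the
    exponential moments, its logarithm the test function of the lower bound and the log-density of
    the channel. *)
Lemma normal_pdf_ratio m s m' s' x : 0 < s -> 0 < s' ->
  normal_pdf m' s' x = normal_pdf m s x * (s / s') *
    expR ((x - m) ^+ 2 / (s ^+ 2 *+ 2) - (x - m') ^+ 2 / (s' ^+ 2 *+ 2)).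
Proof.
move=> s0 s'0; rewrite !normal_pdfE ?gt_eqF // (normal_peakM s0).
rewrite (normal_peakM s'0) /normal_fun.
have -> : expR (- (x - m') ^+ 2 / (s' ^+ 2 *+ 2)) =
  expR (- (x - m) ^+ 2 / (s ^+ 2 *+ 2)) *
  expR ((x - m) ^+ 2 / (s ^+ 2 *+ 2) - (x - m') ^+ 2 / (s' ^+ 2 *+ 2)).
  by rewrite -expRD; congr expR; rewrite addrA !mulNr addNr add0r.
by field; rewrite !gt_eqF.
Qed.

Lemma ge0_integral_normal m s (f : R -> \bar R) :
  measurable_fun setT f -> (forall x, 0 <= f x)%E ->
  (\int[normal_prob m s]_x f x = \int[leb]_x (f x * (normal_pdf m s x)%:E))%E.
Proof.
move=> mf f0; apply: ge0_integral_density => //.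
  by move=> x; exact: normal_pdf_ge0.
exact: measurable_normal_pdf.
Qed.

Lemma normal_change_of_params m s m' s' : 0 < s -> 0 < s' ->
  (\int[normal_prob m s]_x (s / s' *
    expR ((x - m) ^+ 2 / (s ^+ 2 *+ 2) - (x - m') ^+ 2 / (s' ^+ 2 *+ 2)))%:E
  = 1)%E.
Proof.
move=> s0 s'0; rewrite ge0_integral_normal.
- rewrite -(integral_normal_pdf m' s'); apply: eq_integral => x _.
  by rewrite -EFinM (normal_pdf_ratio m m' x s0 s'0) mulrC mulrA.
- apply/measurable_EFinP; apply: measurable_funM => //.
  apply: measurableT_comp => //; apply: measurable_funB.
    by apply: measurable_funM => //; apply: measurable_funX; exact: measurable_funB.
  by apply: measurable_funM => //; apply: measurable_funX; exact: measurable_funB.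
- by move=> x; rewrite lee_fin mulr_ge0 ?expR_ge0 // divr_ge0 ?ltW.
Qed.

Definition reflection (c : R) : measurableTypeR R -> measurableTypeR R :=
  fun x => c - x.

Let measurable_reflection c : measurable_fun setT (reflection c).
Proof. by apply: measurable_funB. Qed.

Lemma lebesgue_measure_reflection (c : R) (A : set R) : measurable A ->
  pushforward leb (reflection c) A = leb A.
Proof.
move=> mA; apply/esym/lebesgue_measure_unique => //= _ [[a b]] _ <-.
(* Reflection exchanges the open and the closed end of the interval and keeps its length. *)
rewrite /pushforward [X in _ = leb X](_ : _ = `[c - b, c - a[%classic).
  rewrite !lebesgue_measure_itv /= !lte_fin ltrD2l ltrN2; case: ifP => // _.
  by rewrite -!EFinB; congr EFin; lra.
apply/seteqP; split => x /=; rewrite /reflection !in_itv /= => /andP[h1 h2].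
  by apply/andP; split; lra.
by apply/andP; split; lra.
Qed.

(** This symmetry cancels first-order terms while every integrand stays nonnegative, so no
    integrability is required. *)
Lemma ge0_integral_normal_reflection m s (f : R -> \bar R) : 0 < s ->
  measurable_fun setT f -> (forall x, 0 <= f x)%E ->
  (\int[normal_prob m s]_x f x = \int[normal_prob m s]_x f (m *+ 2 - x)%R)%E.
Proof.
move=> s0 mf f0.
rewrite !ge0_integral_normal //; last first.
  exact: (measurableT_comp mf (measurable_reflection (m *+ 2))).
have mh : measurable_fun setT (fun x => (f x * (normal_pdf m s x)%:E)%E).
  apply: emeasurable_funM => //; apply/measurable_EFinP.
  exact: measurable_normal_pdf.
have h0 : {in setT, forall x, (0 <= f x * (normal_pdf m s x)%:E)%E}.
  by move=> x _; rewrite mule_ge0 // lee_fin normal_pdf_ge0.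
have e := ge0_integral_pushforward (measurable_reflection (m *+ 2)) leb
  measurableT mh h0.
transitivity (\int[pushforward leb (reflection (m *+ 2))]_x
    (f x * (normal_pdf m s x)%:E))%E.
  apply: eq_measure_integral => //= A mA _.
  by rewrite lebesgue_measure_reflection.
rewrite {}e preimage_setT; apply: eq_integral => x _.
congr (_ * (_)%:E)%E.
rewrite !normal_pdfE ?gt_eqF // /normal_fun /reflection.
have -> : m *+ 2 - x - m = - (x - m) by rewrite mulr2n; ring.
by rewrite sqrrN.
Qed.

Lemma measurable_sqrB (a : R) : measurable_fun setT (fun x : R => (x - a) ^+ 2).
Proof. by apply: measurable_funX; exact: measurable_funB. Qed.

(** The exponent is parametrized by the deviation [s'] of the tilted normal law, whose total mass 1
    gives the value. The coefficient [c] is positive or negative according to whether [s'] exceeds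
    [s]. *)
Lemma integral_normal_expR_sqr m s s' : 0 < s -> 0 < s' ->
  let c := (s ^+ 2 *+ 2)^-1 - (s' ^+ 2 *+ 2)^-1 in
  (\int[normal_prob m s]_x (expR (c * (x - m) ^+ 2))%:E = (s' / s)%:E)%E.
Proof.
move=> s0 s'0 c; have ss' : 0 < s' / s by rewrite divr_gt0.
have mc : measurable_fun setT (fun x : R => expR (c * (x - m) ^+ 2)).
  apply: measurableT_comp => //; apply: measurable_funM => //.
  exact: measurable_sqrB.
have -> : (s' / s)%:E = ((s' / s)%:E * 1)%E by rewrite mule1.
rewrite -(normal_change_of_params m m s0 s'0) -ge0_integralZl //=.
- apply: eq_integral => x _; rewrite -EFinM; congr EFin.
  rewrite [RHS]mulrA (_ : s' / s * (s / s') = 1) ?mul1r; last by field; rewrite !gt_eqF.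
  by congr expR; rewrite /c; ring.
- apply/measurable_EFinP; apply: measurable_funM => //.
  apply: measurableT_comp => //; apply: measurable_funB;
    apply: measurable_funM => //; exact: measurable_sqrB.
- by move=> x _; rewrite lee_fin mulr_ge0 ?expR_ge0 // divr_ge0 ?ltW.
- by rewrite lee_fin ltW.
Qed.

Lemma integrable_normal_sqr m s : 0 < s ->
  (normal_prob m s).-integrable setT (fun x => ((x - m) ^+ 2)%:E).
Proof.
move=> s0; have s20 : 0 < s *+ 2 by rewrite pmulrn_lgt0.
(* Doubling the deviation gives a positive [c] with a finite exponential moment, and
   [c u <= exp (c u)] then dominates the square. *)
pose c := (s ^+ 2 *+ 2)^-1 - ((s *+ 2) ^+ 2 *+ 2)^-1.
have c0 : 0 < c.
  rewrite (_ : c = 3 / (8 * s ^+ 2)) ?divr_gt0 ?mulr_gt0 ?exprn_gt0 //.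
  by rewrite /c; field; rewrite !gt_eqF.
pose h x := (c^-1 * expR (c * (x - m) ^+ 2))%:E.
apply: (@le_integrable _ _ R (normal_prob m s) setT measurableT _ h).
- by apply/measurable_EFinP; exact: measurable_sqrB.
- move=> x _; rewrite lee_fin ger0_norm ?sqr_ge0 //.
  rewrite ger0_norm ?mulr_ge0 ?expR_ge0 ?invr_ge0 ?(ltW c0) //.
  rewrite -ler_pdivrMl ?invr_gt0 // invrK.
  by apply: le_trans (expR_ge1Dx _); rewrite lerDr.
- under [X in _.-integrable _ X]eq_fun do rewrite EFinM.
  apply: integrableZl => //; apply/integrableP; split.
    apply/measurable_EFinP; apply: measurableT_comp => //.
    by apply: measurable_funM => //; exact: measurable_sqrB.
  under eq_integral do rewrite gee0_abs ?lee_fin ?expR_ge0 //.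
  by rewrite (integral_normal_expR_sqr m s0 s20) ltry.
Qed.

(* [1 + u <= exp u] is integrated at [u = c * (x - m) ^+ 2], where [c] is chosen
   so that the tilted law has the second moment [M] as its variance: then
   [1 + c * M <= t] reads [(t - 1) ^+ 2 <= 0] for [t = sqrt M / s]. *)
Lemma normal_second_moment m s : 0 < s ->
  (\int[normal_prob m s]_x ((x - m) ^+ 2)%:E = (s ^+ 2)%:E)%E.
Proof.
move=> s0; set P := normal_prob m s.
have iZ := integrable_normal_sqr m s0.
rewrite -[LHS]fineK ?integrable_fin_num //; congr EFin.
set M := fine _; have M0 : 0 <= M.
  by apply: fine_ge0; apply: integral_ge0 => x _; rewrite lee_fin sqr_ge0.
have key t : 0 < t ->
    1 + ((s ^+ 2 *+ 2)^-1 - (t ^+ 2 *+ 2)^-1) * M <= t / s.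
  move=> t0; set c := _ - _.
  have ic : P.-integrable setT (fun x => (c * (x - m) ^+ 2)%:E).
    by under [X in _.-integrable _ X]eq_fun do rewrite EFinM; exact: integrableZl.
  rewrite -lee_fin -(integral_normal_expR_sqr m s0 t0) -/c -/P.
  rewrite (_ : (1 + c * M)%:E = \int[P]_x (1 + c * (x - m) ^+ 2)%:E)%E.
    apply: le_integral => //.
    - under [X in _.-integrable _ X]eq_fun do rewrite EFinD.
      by apply: integrableD => //; exact: finite_measure_integrable_cst.
    - apply/integrableP; split.
        apply/measurable_EFinP; apply: measurableT_comp => //.
        by apply: measurable_funM => //; exact: measurable_sqrB.
      under eq_integral do rewrite gee0_abs ?lee_fin ?expR_ge0 //.
      by rewrite (integral_normal_expR_sqr m s0 t0) ltry.
    - by move=> x _; rewrite lee_fin expR_ge1Dx.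
  under eq_integral do rewrite EFinD.
  rewrite integralD //; last exact: finite_measure_integrable_cst.
  rewrite integral_cst // mul1e EFinD; congr (_ + _)%E.
    exact/esym/(@probability_setT _ _ _ (normal_prob m s)).
  under eq_integral do rewrite EFinM.
  by rewrite integralZl // EFinM fineK // integrable_fin_num.
(* If [M] were 0, [key] at [s / 2] would say [1 <= 1 / 2]. *)
have := M0; rewrite le_eqVlt => /predU1P[M_eq0|M_gt0].
  have /key : 0 < s / 2 by rewrite divr_gt0.
  by rewrite -M_eq0 mulr0 addr0 mulrAC divff ?gt_eqF //; lra.
have r0 : 0 < Num.sqrt M by rewrite sqrtr_gt0.
have ME : M = Num.sqrt M ^+ 2 by rewrite sqr_sqrtr.
move: (key _ r0); move: r0 ME; set r := Num.sqrt M => r0 ->.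
rewrite (_ : 1 + _ = (1 + (r / s) ^+ 2) / 2); last first.
  by field; rewrite !gt_eqF.
move=> h; have : (r / s - 1) ^+ 2 <= 0 by nra.
rewrite real_exprn_even_le0 //= ?num_real // subr_eq0 => /eqP rs.
by rewrite -[r](divfK (lt0r_neq0 s0)) rs mul1r.
Qed.

(** Adding the reflected integral removes the cross term: [(x - y)^2 + (x - (2 m - y))^2 = 2 (x -
    m)^2 + 2 (y - m)^2]. *)
Lemma integral_normal_sqrB m s x : 0 < s ->
  (\int[normal_prob m s]_y ((x - y) ^+ 2)%:E = ((x - m) ^+ 2 + s ^+ 2)%:E)%E.
Proof.
move=> s0; set P := normal_prob m s.
have mf a : measurable_fun setT (fun y : R => ((a - y) ^+ 2)%:E).
  by apply/measurable_EFinP; apply: measurable_funX; exact: measurable_funB.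
have f0 a (y : R) : (0 <= ((a - y) ^+ 2)%:E)%E by rewrite lee_fin sqr_ge0.
have e2 : (\int[P]_y ((x - y) ^+ 2)%:E + \int[P]_y ((x - y) ^+ 2)%:E =
    ((x - m) ^+ 2 + s ^+ 2)%:E + ((x - m) ^+ 2 + s ^+ 2)%:E)%E.
  rewrite [X in (_ + X)%E](ge0_integral_normal_reflection m s0 (mf x) (f0 x)).
  have mf2 : measurable_fun setT (fun y : R => ((x - (m *+ 2 - y)) ^+ 2)%:E).
    apply/measurable_EFinP; apply: measurable_funX; apply: measurable_funB => //.
    exact: measurable_funB.
  rewrite -(ge0_integralD P measurableT (fun y _ => f0 x y) (mf x)
    (fun y _ => f0 x _) mf2).
  transitivity (\int[P]_y (((x - m) ^+ 2 *+ 2)%:E + 2%:E * ((y - m) ^+ 2)%:E))%E.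
    by apply: eq_integral => y _; rewrite -EFinM -!EFinD; congr EFin; ring.
  rewrite ge0_integralD //=.
  - rewrite integral_cst // ge0_integralZl //=.
    + rewrite normal_second_moment //.
      rewrite [X in (_ * X + _)%E](@probability_setT _ _ _ (normal_prob m s)) mule1.
      by rewrite -EFinM -!EFinD; congr EFin; ring.
    + by apply/measurable_EFinP; exact: measurable_sqrB.
  - by move=> y _; rewrite lee_fin; apply: mulrn_wge0; exact: sqr_ge0.
  - by move=> y _; rewrite -EFinM lee_fin; apply: mulr_ge0 => //; exact: sqr_ge0.
  - apply/measurable_EFinP; apply: measurable_funM => //.
    exact: measurable_sqrB.
move: e2; case: (integral _ _ _) => [r|//|//] /=.
by rewrite -!EFinD => -[e]; congr EFin; lra.
Qed.

End normal_facts.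

(** * Estimating a Gaussian source *)

Lemma cvg_Rintegral_dominated d (T : measurableType d) (R : realType)
    (mu : {measure set T -> \bar R}) (f_ : nat -> T -> R) (f G : T -> R) :
  (forall n, measurable_fun setT (f_ n)) ->
  (forall x, f_ n x @[n --> \oo] --> f x) ->
  (forall n x, `|f_ n x| <= G x) ->
  mu.-integrable setT (EFin \o G) ->
  \int[mu]_x f_ n x @[n --> \oo] --> \int[mu]_x f x.
Proof.
move=> mf cf fG iG.
have mEf n : measurable_fun setT (EFin \o f_ n) by exact/measurable_EFinP.
have cEf x : setT x -> (EFin \o f_ n) x @[n --> \oo] --> (EFin \o f) x.
  by move=> _; apply/fine_cvgP; split; [exact: nearW|exact: cf].
have mEf' : measurable_fun setT (EFin \o f).
  exact: (emeasurable_fun_cvg (fun n => EFin \o f_ n)).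
have [] := dominated_convergence measurableT mEf mEf' (aeW _ cEf) iG.
  by apply: aeW => x n _; rewrite lee_fin.
move=> iF _; rewrite -[X in _ --> X -> _]fineK ?integrable_fin_num //.
by move=> /fine_cvgP[_].
Qed.

Lemma ge0_integral_law dO (Omega : measurableType dO) d (T : measurableType d)
    (R : realType) (P : {measure set Omega -> \bar R}) (X : Omega -> T)
    (Q : {measure set T -> \bar R}) (h : T -> \bar R) :
  measurable_fun setT X ->
  (forall A, measurable A -> P (X @^-1` A) = Q A) ->
  measurable_fun setT h -> (forall x, 0 <= h x)%E ->
  (\int[P]_w h (X w) = \int[Q]_x h x)%E.
Proof.
move=> mX lawX mh h0.
have := ge0_integral_pushforward mX P measurableT mh (fun x _ => h0 x).
rewrite preimage_setT => <-; apply: eq_measure_integral => A mA _.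
exact: lawX.
Qed.

Lemma integrable_sqrB d (T : measurableType d) (R : realType)
    (mu : {measure set T -> \bar R}) (f g : T -> R) :
  measurable_fun setT f -> measurable_fun setT g ->
  mu.-integrable setT (fun x => (f x ^+ 2)%:E) ->
  mu.-integrable setT (fun x => (g x ^+ 2)%:E) ->
  mu.-integrable setT (fun x => ((f x - g x) ^+ 2)%:E).
Proof.
move=> mf mg if2 ig2.
pose h x := (2%:E * (f x ^+ 2)%:E + 2%:E * (g x ^+ 2)%:E)%E.
apply: (le_integrable measurableT (g := h)).
- by apply/measurable_EFinP; apply: measurable_funX; exact: measurable_funB.
- move=> x _; rewrite /h -!EFinM -EFinD lee_fin.
  rewrite ger0_norm ?sqr_ge0 // ger0_norm; last first.
    by apply: addr_ge0; apply: mulr_ge0 => //; exact: sqr_ge0.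
  have := sqr_ge0 (f x + g x); nra.
- by apply: integrableD => //; exact: integrableZl.
Qed.

Section gaussian_source.
Context dO (Omega : measurableType dO) d (T : measurableType d) (R : realType).
Variables (P : probability Omega R) (X : Omega -> R) (Z : Omega -> T).
Hypotheses (mX : measurable_fun setT X) (mZ : measurable_fun setT Z).
Variables (mu s : R).
Hypothesis s_gt0 : 0 < s.
Hypothesis lawX : forall A, measurable A -> P (X @^-1` A) = normal_prob mu s A.

Lemma ge0_integral_source (h : R -> \bar R) : measurable_fun setT h ->
  (forall x, 0 <= h x)%E ->
  (\int[P]_w h (X w) = \int[normal_prob mu s]_x h x)%E.
Proof. exact: (ge0_integral_law (Q := normal_prob mu s) mX lawX). Qed.

Lemma integral_source_sqr : (\int[P]_w ((X w - mu) ^+ 2)%:E = (s ^+ 2)%:E)%E.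
Proof.
rewrite (ge0_integral_source (h := fun x : R => ((x - mu) ^+ 2)%:E)).
- exact: normal_second_moment.
- by apply/measurable_EFinP; exact: measurable_sqrB.
- by move=> x; rewrite lee_fin sqr_ge0.
Qed.

Lemma integrable_source_sqr (a : R) :
  P.-integrable setT (fun w => ((X w - a) ^+ 2)%:E).
Proof.
have i1 : P.-integrable setT (fun w => ((X w - mu) ^+ 2)%:E).
  apply/integrableP; split.
    apply/measurable_EFinP.
    exact: (measurableT_comp (measurable_sqrB mu) mX).
  under eq_integral do rewrite gee0_abs ?lee_fin ?sqr_ge0 //.
  by rewrite integral_source_sqr ltry.
have -> : (fun w => ((X w - a) ^+ 2)%:E) =
    (fun w => ((X w - mu - (a - mu)) ^+ 2)%:E).
  by apply/funext => w; congr ((_ ^+ 2)%:E); ring.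
apply: integrable_sqrB => //; first exact: measurable_funB.
exact: finite_measure_integrable_cst.
Qed.

Lemma integrable_source_sqr0 : P.-integrable setT (fun w => (X w ^+ 2)%:E).
Proof. by have := integrable_source_sqr 0; under eq_fun do rewrite subr0. Qed.

Variable J : set R -> set T -> \bar R.
Hypothesis JE : forall A B, measurable A -> measurable B ->
  J A B = P (X @^-1` A `&` Z @^-1` B).

Section test_function.
Variable del : R.
Hypotheses (del_gt0 : 0 < del) (lt_del_s : del < s).

(* The log-likelihood ratio of the backward Gaussian test channel. *)
Let F (x v : R) := ln (s / del) +
  ((x - mu) ^+ 2 / (s ^+ 2 *+ 2) - (x - v) ^+ 2 / (del ^+ 2 *+ 2)).

Let measurable_F v : measurable_fun setT (F ^~ v).
Proof.
apply: measurable_funD => //; apply: measurable_funB;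
  apply: measurable_funM => //; exact: measurable_sqrB.
Qed.

(** Since [del < s], [F] is a concave quadratic in [x], and completing the square gives its maximum.
    The bound dominates [expR F] when [X] is refined. *)
Let F_ub v : exists C, forall x, F x v <= C.
Proof.
exists (ln (s / del) + (mu - v) ^+ 2 / (s ^+ 2 *+ 2 - del ^+ 2 *+ 2)) => x.
rewrite lerD2l -subr_ge0.
have d0 : 0 < s ^+ 2 - del ^+ 2 by rewrite subr_gt0 ltr_pXn2r ?nnegrE ?ltW.
rewrite (_ : _ - _ = ((s ^+ 2 - del ^+ 2) * (x - v) - del ^+ 2 * (v - mu)) ^+ 2
    / ((s ^+ 2 - del ^+ 2) * s ^+ 2 * del ^+ 2 *+ 2)).
  by rewrite divr_ge0 ?sqr_ge0 // mulrn_wge0 // ltW // !mulr_gt0.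
by field; rewrite -mulrBl !gt_eqF //= mulr_gt0.
Qed.

(** The integrand is the likelihood ratio of [N(v, del^2)] to the law of [X], so the integral is a
    total mass. The normalization term of the variational bound therefore tends to 1. *)
Let Rintegral_expR_F v : \int[P]_w expR (F (X w) v) = 1.
Proof.
have mE : measurable_fun setT (fun x => (expR (F x v))%:E).
  by apply/measurable_EFinP; apply: measurableT_comp => //; exact: measurable_F.
rewrite /Rintegral (ge0_integral_source mE); last first.
  by move=> x; rewrite lee_fin expR_ge0.
rewrite -[RHS]/(fine 1%E) -(normal_change_of_params mu v s_gt0 del_gt0).
congr fine; apply: eq_integral => x _.
by rewrite /F expRD lnK // posrE divr_gt0.
Qed.

(** One function of [x] bounds [F] at all quantizations [t] of [x] simultaneously. *)
Let F_dominated v B x t : `|t| <= `|x| -> `|v| <= B ->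
  `|F t v| <= (`|ln (s / del)| + mu ^+ 2 / s ^+ 2 + B ^+ 2 / del ^+ 2) +
    (1 / s ^+ 2 + 1 / del ^+ 2) * x ^+ 2.
Proof.
move=> tx vB.
have t2 : t ^+ 2 <= x ^+ 2 by rewrite -(real_normK (num_real t)) -(real_normK (num_real x)) lerXn2r ?nnegrE.
have B0 : 0 <= B by exact: le_trans vB.
have v2 : v ^+ 2 <= B ^+ 2 by rewrite -(real_normK (num_real v)) lerXn2r ?nnegrE.
have h1 : 0 <= (t - mu) ^+ 2 / (s ^+ 2 *+ 2) <= mu ^+ 2 / s ^+ 2 + 1 / s ^+ 2 * x ^+ 2.
  rewrite divr_ge0 ?sqr_ge0 ?mulrn_wge0 ?sqr_ge0 //=.
  rewrite ler_pdivrMr ?pmulrn_lgt0 ?exprn_gt0 //.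
  rewrite [leRHS](_ : _ = mu ^+ 2 *+ 2 + x ^+ 2 *+ 2); last first.
    by field; rewrite gt_eqF.
  have := sqr_ge0 (t + mu); nra.
have h2 : 0 <= (t - v) ^+ 2 / (del ^+ 2 *+ 2) <= B ^+ 2 / del ^+ 2 + 1 / del ^+ 2 * x ^+ 2.
  rewrite divr_ge0 ?sqr_ge0 ?mulrn_wge0 ?sqr_ge0 //=.
  rewrite ler_pdivrMr ?pmulrn_lgt0 ?exprn_gt0 //.
  rewrite [leRHS](_ : _ = B ^+ 2 *+ 2 + x ^+ 2 *+ 2); last first.
    by field; rewrite gt_eqF.
  have := sqr_ge0 (t + v); nra.
have h3 := ler_norm (ln (s / del)); have h4 := ler_norm (- ln (s / del)).
rewrite normrN in h4; rewrite ler_norml /F; move: h1 h2 => /andP[? ?] /andP[? ?].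
by apply/andP; split; lra.
Qed.

(** Only [X] is refined. Since [v] takes finitely many values, the normalization term is a finite
    sum and the limit can be taken in each summand; the left side is the limiting mean of [F]. *)
Lemma mutinfo_ge_quantized_estimator (v : T -> R) (M : R) : quantized v ->
  (mutinfo J <= M%:E)%E ->
  ln (s / del) + 2^-1 - (\int[P]_w ((X w - v (Z w)) ^+ 2)) / (del ^+ 2 *+ 2)
    <= ln 2 * M.
Proof.
move=> qv JM; have [mv _] := qv.
have [m [jdx [b [mj vE]]]] := quantized_index qv.
have [t [qt tle tcv]] := quantized_approximation (@measurable_id _ R setT).
have [B vB] : exists B, forall z, `|v z| <= B.
  exists (\sum_j `|b j|) => z; rewrite vE /= (bigD1 (jdx z)) //= lerDl.
  by apply: sumr_ge0 => j _; exact: normr_ge0.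
have mt n : measurable_fun setT (t n) by have [] := qt n.
have mvZ : measurable_fun setT (fun w => v (Z w)) by exact: measurableT_comp.
have mtX n : measurable_fun setT (fun w => t n (X w)) by exact: measurableT_comp.
pose rj j := fine (P (Z @^-1` (jdx @^-1` [set j]))).
have step n : \int[P]_w F (t n (X w)) (v (Z w)) + 1
    - \sum_j rj j * \int[P]_w expR (F (t n (X w)) (b j)) <= ln 2 * M.
  have [N [idx [a [mi tE]]]] := quantized_index (qt n).
  have := mutinfo_ge_indexed mX mZ JE mi mj (fun i j => F (a i) (b j)) JM.
  have -> : t n = a \o idx by apply/funext.
  by have -> : v = b \o jdx by apply/funext.
have cF w v' : F (t n (X w)) v' @[n --> \oo] --> F (X w) v'.
  have ct := tcv (X w).
  apply: cvgD; first exact: cvg_cst.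
  apply: cvgB; (apply: cvgM; last exact: cvg_cst);
    rewrite expr2; under eq_fun do rewrite expr2;
    by apply: cvgM; apply: cvgB => //; exact: cvg_cst.
have lim1 : \int[P]_w F (t n (X w)) (v (Z w)) @[n --> \oo] -->
    \int[P]_w F (X w) (v (Z w)).
  apply: (cvg_Rintegral_dominated _ _ (fun n w => F_dominated (tle n (X w)) (vB (Z w)))).
  - move=> n; apply: measurable_funD => //; apply: measurable_funB;
      (apply: measurable_funM => //; apply: measurable_funX; exact: measurable_funB).
  - by move=> w; exact: cF.
  - under [X in _.-integrable _ X]eq_fun do rewrite EFinD EFinM.
    apply: integrableD => //; last first.
      exact: integrableZl integrable_source_sqr0.
    exact: finite_measure_integrable_cst.
have lim2 j : \int[P]_w expR (F (t n (X w)) (b j)) @[n --> \oo] --> (1 : R).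
  have [C hC] := F_ub (b j); rewrite -(Rintegral_expR_F (b j)).
  apply: (@cvg_Rintegral_dominated _ _ _ _ _ _ (cst (expR C))).
  - by move=> n; apply: measurableT_comp => //; exact: measurableT_comp (measurable_F _) _.
  - move=> w; apply: (cvg_comp _ expR (cF w (b j))); exact: continuous_expR.
  - by move=> n w; rewrite ger0_norm ?expR_ge0 //= ler_expR.
  - exact: finite_measure_integrable_cst.
have sum_r : \sum_j rj j = 1.
  have mjZ j : measurable ((jdx \o Z) @^-1` [set j]).
    rewrite -[X in measurable X]setTI comp_preimage; exact: mZ.
  have := Rintegral_finite_fibers P (fun=> 1) mjZ; rewrite Rintegral_cst // mul1r.
  have -> : fine (P setT) = 1 by rewrite probability_setT.
  by under eq_bigr do rewrite mul1r.
(* In the limit the [+ 1] cancels the normalization term. *)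
have lim : \int[P]_w F (t n (X w)) (v (Z w)) + 1
    - \sum_j rj j * \int[P]_w expR (F (t n (X w)) (b j)) @[n --> \oo] -->
    \int[P]_w F (X w) (v (Z w)).
  rewrite [X in _ --> X](_ : _ = \int[P]_w F (X w) (v (Z w)) + 1
    - \sum_j rj j * 1); last first.
    by under eq_bigr do rewrite mulr1; rewrite sum_r addrK.
  apply: cvgB; first by apply: cvgD => //; exact: cvg_cst.
  apply: (cvg_big add_continuous) => j _.
  by apply: cvgM => //; exact: cvg_cst.
have i1 := integrable_source_sqr mu.
have i2 : P.-integrable setT (fun w => ((X w - v (Z w)) ^+ 2)%:E).
  apply: integrable_sqrB => //; first exact: integrable_source_sqr0.
  apply: (le_integrable measurableT (g := cst (B ^+ 2)%:E)).
  - by apply/measurable_EFinP; exact: measurable_funX.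
  - move=> w _; rewrite lee_fin !ger0_norm ?sqr_ge0 //.
    rewrite -(real_normK (num_real (v _))) lerXn2r ?nnegrE //.
    exact: le_trans (vB (Z w)).
  - exact: finite_measure_integrable_cst.
(* The half is [E (X - mu)^2 / (2 s^2)]. *)
have -> : ln (s / del) + 2^-1 - (\int[P]_w ((X w - v (Z w)) ^+ 2)) / (del ^+ 2 *+ 2)
    = \int[P]_w F (X w) (v (Z w)).
  have i1' : P.-integrable setT (EFin \o (fun w => (X w - mu) ^+ 2 / (s ^+ 2 *+ 2))).
    by rewrite /comp; under eq_fun do rewrite EFinM; exact: integrableZr.
  have i2' : P.-integrable setT
      (EFin \o (fun w => (X w - v (Z w)) ^+ 2 / (del ^+ 2 *+ 2))).
    by rewrite /comp; under eq_fun do rewrite EFinM; exact: integrableZr.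
  rewrite RintegralD //; last 2 first.
  - exact: finite_measure_integrable_cst.
  - by have := integrableB measurableT i1' i2'.
  rewrite RintegralB // RintegralZr // RintegralZr // Rintegral_cst //.
  have -> : fine (P setT) = 1 by rewrite probability_setT.
  rewrite mulr1 [in RHS]/Rintegral integral_source_sqr /= -addrA; congr (_ + (_ - _)).
  by field; rewrite gt_eqF.
rewrite -(cvg_lim _ lim) //; apply: limr_le; first by apply/cvg_ex; eexists; exact: lim.
by apply: nearW.
Qed.

End test_function.

(** An error of at most [del^2] makes the quadratic term at most one half, so it is absorbed by the
    half of the quantized bound and [ln (s / del)] remains. *)
Lemma mutinfo_ge_estimator (v : T -> R) (del : R) : measurable_fun setT v ->
  0 < del -> del < s ->
  (\int[P]_w ((X w - v (Z w)) ^+ 2)%:E <= (del ^+ 2)%:E)%E ->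
  ((log2 (s / del))%:E <= mutinfo J)%E.
Proof.
move=> mv del0 dels le_del.
case JM : (mutinfo J) => [M| |]; [|exact: leey|]; last first.
  by have := mutinfo_ge0 JE; rewrite JM.
have {}JM : (mutinfo J <= M%:E)%E by rewrite JM.
rewrite lee_fin /log2 ler_pdivrMr ?ln2_gt0 // [leRHS]mulrC.
have [t [qt tle tcv]] := quantized_approximation mv.
have mvZ : measurable_fun setT (fun w => v (Z w)) by exact: measurableT_comp.
have iXv : P.-integrable setT (fun w => ((X w - v (Z w)) ^+ 2)%:E).
  apply/integrableP; split.
    by apply/measurable_EFinP; apply: measurable_funX; exact: measurable_funB.
  under eq_integral do rewrite gee0_abs ?lee_fin ?sqr_ge0 //.
  by rewrite (le_lt_trans le_del) // ltry.
(* The estimator is square integrable as the source minus the error; together with [X] it dominates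
   the quantized errors. *)
have iv : P.-integrable setT (fun w => (v (Z w) ^+ 2)%:E).
  have -> : (fun w => (v (Z w) ^+ 2)%:E) =
      (fun w => ((X w - (X w - v (Z w))) ^+ 2)%:E).
    by apply/funext => w; congr ((_ ^+ 2)%:E); ring.
  apply: integrable_sqrB => //; first exact: measurable_funB.
  exact: integrable_source_sqr0.
have lim : \int[P]_w ((X w - t n (Z w)) ^+ 2) @[n --> \oo] -->
    \int[P]_w ((X w - v (Z w)) ^+ 2).
  apply: (@cvg_Rintegral_dominated _ _ _ _ _ _
    (fun w => 2 * X w ^+ 2 + 2 * v (Z w) ^+ 2)).
  - move=> n; apply: measurable_funX; apply: measurable_funB => //.
    by apply: measurableT_comp => //; have [] := qt n.
  - move=> w; under eq_fun do rewrite expr2; rewrite expr2.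
    by apply: cvgM; apply: cvgB => //; exact: cvg_cst.
  - move=> n w; rewrite ger0_norm ?sqr_ge0 //.
    have h : t n (Z w) ^+ 2 <= v (Z w) ^+ 2.
      rewrite -(real_normK (num_real (t n _))) -(real_normK (num_real (v _))).
      by rewrite lerXn2r ?nnegrE.
    have := sqr_ge0 (X w + t n (Z w)); nra.
  - rewrite /comp; under eq_fun do rewrite EFinD !EFinM.
    by apply: integrableD => //; apply: integrableZl => //;
      exact: integrable_source_sqr0.
have lim' : ln (s / del) + 2^-1
    - (\int[P]_w ((X w - t n (Z w)) ^+ 2)) / (del ^+ 2 *+ 2) @[n --> \oo] -->
    ln (s / del) + 2^-1 - (\int[P]_w ((X w - v (Z w)) ^+ 2)) / (del ^+ 2 *+ 2).
  apply: cvgB; first exact: cvg_cst.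
  by apply: cvgM => //; exact: cvg_cst.
have : ln (s / del) + 2^-1
    - (\int[P]_w ((X w - v (Z w)) ^+ 2)) / (del ^+ 2 *+ 2) <= ln 2 * M.
  rewrite -(cvg_lim _ lim') //; apply: limr_le.
    by apply/cvg_ex; eexists; exact: lim'.
  by apply: nearW => n; exact: mutinfo_ge_quantized_estimator.
apply: le_trans; rewrite -addrA lerDl subr_ge0.
rewrite ler_pdivrMr ?pmulrn_lgt0 ?exprn_gt0 // mulrnAr -mulrnAl.
rewrite (_ : 2^-1 *+ 2 = 1) ?mul1r; last by field.
by rewrite -lee_fin [X in (X <= _)%E]fineK // integrable_fin_num.
Qed.

End gaussian_source.

(** * The Gaussian channel *)

(* [normal_prob] lives on [measurableTypeR R], whose display differs from the one
   of [R] used in kernels; [normal_law] is its copy on the latter. *)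
Section normal_law.
Context (R : realType).
Variables m s : R.

Definition normal_law : set R -> \bar R := normal_prob m s.

Let normal_law0 : normal_law set0 = 0%E.
Proof. exact: (@measure0 _ _ _ (normal_prob m s)). Qed.

Let normal_law_ge0 A : (0 <= normal_law A)%E.
Proof. exact: (@measure_ge0 _ _ _ (normal_prob m s)). Qed.

Let normal_law_sigma_additive : semi_sigma_additive normal_law.
Proof. exact: (@measure_semi_sigma_additive _ _ _ (normal_prob m s)). Qed.

HB.instance Definition _ := isMeasure.Build _ _ _ normal_law
  normal_law0 normal_law_ge0 normal_law_sigma_additive.

Let normal_lawT : normal_law setT = 1%E.
Proof. exact: (@probability_setT _ _ _ (normal_prob m s)). Qed.

HB.instance Definition _ :=
  @Measure_isProbability.Build _ _ R normal_law normal_lawT.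

Lemma ge0_integral_normal_law (h : R -> \bar R) : measurable_fun setT h ->
  (forall x, 0 <= h x)%E ->
  (\int[normal_prob m s]_x h x = \int[normal_law]_x h x)%E.
Proof.
exact: (@ge0_integral_law _ (measurableTypeR R) _ R R (normal_prob m s)
  id normal_law h (@measurable_id _ R setT)).
Qed.

Lemma ge0_integral_normal_law_in (A : set R) (h : R -> \bar R) : measurable A ->
  measurable_fun setT h -> (forall x, 0 <= h x)%E ->
  (\int[normal_prob m s]_(x in A) h x = \int[normal_law]_(x in A) h x)%E.
Proof.
move=> mA mh h0; rewrite integral_mkcond [RHS]integral_mkcond.
apply: ge0_integral_normal_law; last by move=> x; rewrite patchE; case: ifP.
by apply/(measurable_restrictT _ _).1 => //; exact: measurable_funTS.
Qed.

End normal_law.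

Section normal_source.
Context (R : realType) d (T : measurableType d).
Variables (m s : R) (k : R.-pker R ~> T).

Definition source_joint : set (R * T) -> \bar R := kernel_prod (normal_law m s) k.

HB.instance Definition _ := Probability.on source_joint.

Lemma integral_source_joint (f : R * T -> \bar R) : measurable_fun setT f ->
  (forall z, 0 <= f z)%E ->
  (\int[source_joint]_z f z = \int[normal_prob m s]_x \int[k x]_y f (x, y))%E.
Proof.
move=> mf f0; rewrite integral_kernel_prod // ge0_integral_normal_law //.
  exact: (measurable_kfcomp k mf f0).
by move=> x; apply: integral_ge0 => y _; exact: f0.
Qed.

Lemma source_joint_rectangle (A : set R) (B : set T) :
  measurable A -> measurable B ->
  (source_joint (fst @^-1` A `&` snd @^-1` B) =
   \int[normal_prob m s]_(x in A) k x B)%E.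
Proof.
move=> mA mB; rewrite ge0_integral_normal_law_in //.
  exact: kernel_prod_rectangle.
exact: (measurable_kernel k).
Qed.

Lemma source_joint_fst (A : set R) : measurable A ->
  source_joint (fst @^-1` A) = normal_prob m s A.
Proof.
move=> mA; have := source_joint_rectangle mA measurableT.
rewrite preimage_setT setIT => ->.
rewrite (eq_integral (cst 1%E)) ?integral_cst ?mul1e //.
by move=> x _; exact: prob_kernel.
Qed.

End normal_source.

Section gaussian_channel.
Context (R : realType).
Variables (mu s r : R).

Definition channel_mean (x : R) : R := mu + r * (x - mu).
Definition channel_dev : R := s * Num.sqrt (1 - r ^+ 2).

(* The conditional law of [Y] given [X = x] for a Gaussian pair with common
   marginal [N(mu, s^2)] and correlation [r]. *)
Definition channel (x : R) : {measure set R -> \bar R} :=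
  normal_law (channel_mean x) channel_dev.

Notation leb := (@lebesgue_measure R).

Let measurable_channel_pdf : measurable_fun setT
  (fun z : R * R => normal_pdf (channel_mean z.1) channel_dev z.2).
Proof.
(* A zero deviation is not excluded at this point, and [normal_pdf] is then an indicator by
   convention. *)
rewrite /normal_pdf; have [s0|sn0] := eqVneq channel_dev 0.
  by apply: measurableT_comp => //; exact: measurable_indic.
apply: measurable_funM => //; apply: measurableT_comp => //.
apply: measurable_funM => //; apply: measurableT_comp => //.
apply: measurable_funX; apply: measurable_funB => //.
apply: measurable_funD => //; apply: measurable_funM => //.
exact: measurable_funB.
Qed.

Let measurable_channel U : measurable U -> measurable_fun setT (channel ^~ U).
Proof.
move=> mU; pose f (z : R * R) : \bar R :=
  ((normal_pdf (channel_mean z.1) channel_dev z.2)%:E * (\1_U z.2)%:E)%E.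
have -> : channel ^~ U = (fun x => (\int[leb]_y f (x, y))%E).
  apply/funext => x; rewrite /channel /= /normal_law /normal_prob integral_mkcond.
  apply: eq_integral => y _; rewrite /f /= patchE indicE.
  by case: ifP => _; rewrite ?mule1 ?mule0.
apply: measurable_fun_fubini_tonelli_F => //.
  apply: emeasurable_funM; first exact/measurable_EFinP.
  apply/measurable_EFinP; apply: measurableT_comp => //; exact: measurable_indic.
by move=> z; rewrite mule_ge0 // lee_fin normal_pdf_ge0.
Qed.

HB.instance Definition _ :=
  @isKernel.Build _ _ _ _ R channel measurable_channel.

Let channelT x : channel x setT = 1%E.
Proof.
exact: (@probability_setT _ _ _ (normal_law (channel_mean x) channel_dev)).
Qed.

HB.instance Definition _ :=
  @Kernel_isProbability.Build _ _ _ _ R channel channelT.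

Hypotheses (s_gt0 : 0 < s) (r_ge0 : 0 <= r) (r_lt1 : r < 1).

Let r2_gt0 : 0 < 1 - r ^+ 2.
Proof. by rewrite subr_gt0 expr_lt1. Qed.

Lemma channel_dev_gt0 : 0 < channel_dev.
Proof. by rewrite mulr_gt0 // sqrtr_gt0. Qed.

Lemma channel_dev2 : channel_dev ^+ 2 = s ^+ 2 * (1 - r ^+ 2).
Proof. by rewrite exprMn sqr_sqrtr // ltW. Qed.

Let joint_pdf (x y : R) : R :=
  normal_pdf (channel_mean x) channel_dev y * normal_pdf mu s x.

(** With [a = x - mu] and [b = y - mu], the exponent is [- (a^2 - 2 r a b + b^2) / (2 s^2 (1 -
    r^2))], which is symmetric. *)
Let joint_pdf_sym x y : joint_pdf x y = joint_pdf y x.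
Proof.
have t0 := channel_dev_gt0.
rewrite /joint_pdf !normal_pdfE ?gt_eqF // /normal_fun mulrACA [RHS]mulrACA.
rewrite -!expRD; congr (_ * expR _).
rewrite channel_dev2 /channel_mean.
by field; rewrite !gt_eqF.
Qed.

Let integral_joint_pdf (f : R * R -> \bar R) : measurable_fun setT f ->
  (forall z, 0 <= f z)%E ->
  (\int[normal_prob mu s]_x \int[channel x]_y f (x, y) =
   \int[leb]_x \int[leb]_y (f (x, y) * (joint_pdf x y)%:E))%E.
Proof.
move=> mf f0.
have mfx x : measurable_fun setT (fun y => f (x, y)).
  exact: measurableT_comp.
rewrite ge0_integral_normal; last 2 first.
- exact: (measurable_kfcomp channel mf f0).
- by move=> x; apply: integral_ge0 => y _; exact: f0.
apply: eq_integral => x _.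
rewrite -ge0_integral_normal_law // ge0_integral_normal //.
have mp : measurable_fun setT (EFin \o normal_pdf (channel_mean x) channel_dev).
  by apply/measurable_EFinP; exact: measurable_normal_pdf.
rewrite -ge0_integralZr //=; last 3 first.
- exact: (emeasurable_funM (mfx x) mp).
- by move=> y _; rewrite mule_ge0 // lee_fin normal_pdf_ge0.
- by rewrite lee_fin normal_pdf_ge0.
by apply: eq_integral => y _; rewrite -muleA -EFinM.
Qed.

(** Detailed balance, from Tonelli and the symmetry of [joint_pdf]. It yields the invariance of the
    source law, and later lets the decoder be read backwards. *)
Lemma channel_reversible (f : R * R -> \bar R) : measurable_fun setT f ->
  (forall z, 0 <= f z)%E ->
  (\int[normal_prob mu s]_x \int[channel x]_y f (x, y) =
   \int[normal_prob mu s]_y \int[channel y]_x f (x, y))%E.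
Proof.
move=> mf f0.
have mj : measurable_fun setT (fun z : R * R => (joint_pdf z.1 z.2)%:E).
  apply/measurable_EFinP; apply: measurable_funM => //.
  by apply: measurableT_comp => //; exact: measurable_normal_pdf.
pose F z := (f z * (joint_pdf z.1 z.2)%:E)%E.
have mF : measurable_fun setT F by exact: emeasurable_funM.
have F0 z : (0 <= F z)%E.
  by rewrite mule_ge0 // lee_fin mulr_ge0 ?normal_pdf_ge0.
rewrite (integral_joint_pdf mf f0).
rewrite (integral_joint_pdf (f := fun z => f (z.2, z.1))) //; last first.
  by apply: measurableT_comp => //; exact: measurable_swap.
have := @fubini_tonelli _ _ _ _ R leb leb F mF F0.
rewrite /F /= => ->; apply: eq_integral => y _; apply: eq_integral => x _ /=.
by rewrite joint_pdf_sym.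
Qed.

Lemma channel_invariant (h : R -> \bar R) : measurable_fun setT h ->
  (forall z, 0 <= h z)%E ->
  (\int[normal_prob mu s]_x \int[channel x]_y h y =
   \int[normal_prob mu s]_y h y)%E.
Proof.
move=> mh h0; rewrite (channel_reversible (f := fun z => h z.2)) //=; last first.
  exact: measurableT_comp.
apply: eq_integral => y _; rewrite integral_cst //.
by rewrite [X in (_ * X)%E](channelT y) mule1.
Qed.

Lemma channel_marginal C : measurable C ->
  (\int[normal_prob mu s]_x channel x C = normal_prob mu s C)%E.
Proof.
move=> mC; have := channel_invariant (h := EFin \o \1_C).
rewrite /= integral_indic // setIT => <- //.
  by apply: eq_integral => x _; rewrite integral_indic // setIT.
by apply/measurable_EFinP; exact: measurable_indic.
Qed.

(** Squared bias plus variance: [(1 - r)^2 s^2 + (1 - r^2) s^2 = 2 s^2 (1 - r)]. *)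
Lemma channel_distortion : (\int[normal_prob mu s]_x \int[channel x]_y
  ((x - y) ^+ 2)%:E = (s ^+ 2 * (1 - r) *+ 2)%:E)%E.
Proof.
have t0 := channel_dev_gt0.
have mB x : measurable_fun setT (fun y : R => ((x - y) ^+ 2)%:E).
  by apply/measurable_EFinP; apply: measurable_funX; exact: measurable_funB.
have B0 x y : (0 <= ((x - y) ^+ 2 : R)%:E)%E by rewrite lee_fin sqr_ge0.
under eq_integral do
  rewrite -(ge0_integral_normal_law _ _ (mB _) (B0 _)) integral_normal_sqrB //.
transitivity (\int[normal_prob mu s]_x
  (((1 - r) ^+ 2)%:E * ((x - mu) ^+ 2)%:E + (channel_dev ^+ 2)%:E))%E.
  apply: eq_integral => x _; rewrite -EFinM -EFinD; congr ((_ + _)%:E).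
  by rewrite /channel_mean; ring.
rewrite ge0_integralD //=; last 3 first.
- by move=> x _; rewrite -EFinM lee_fin; apply: mulr_ge0; exact: sqr_ge0.
- by apply: emeasurable_funM => //; apply/measurable_EFinP; exact: measurable_sqrB.
- by move=> x _; rewrite lee_fin sqr_ge0.
have m2 : measurable_fun setT (fun x : R => ((x - mu) ^+ 2)%:E).
  by apply/measurable_EFinP; exact: measurable_sqrB.
have p2 (x : R) : setT x -> (0 <= ((x - mu) ^+ 2)%:E)%E.
  by move=> _; rewrite lee_fin sqr_ge0.
rewrite (ge0_integralZl (normal_prob mu s) measurableT m2 p2); last first.
  by rewrite lee_fin sqr_ge0.
rewrite normal_second_moment // integral_cst //.
rewrite [X in (_ + _ * X)%E](@probability_setT _ _ _ (normal_prob mu s)) mule1.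
by rewrite -EFinM -EFinD channel_dev2; congr EFin; ring.
Qed.

End gaussian_channel.

Section channel_information.
Context (R : realType).
Variables (mu s r : R).
Hypotheses (s_gt0 : 0 < s) (r_ge0 : 0 <= r) (r_lt1 : r < 1).

Let K : R.-pker R ~> R := channel mu s r.
Let tau : R := channel_dev s r.
Let tau_gt0 : 0 < tau := channel_dev_gt0 s_gt0 r_ge0 r_lt1.

Let channel_joint := source_joint mu s K.

Let channel_joint2 (B : set R) : measurable B ->
  channel_joint (snd @^-1` B) = normal_prob mu s B.
Proof.
move=> mB; have := source_joint_rectangle mu s K measurableT mB.
rewrite preimage_setT setTI /channel_joint => ->; exact: (channel_marginal mu s_gt0 r_ge0 r_lt1).
Qed.

Let expo (z : R * R) : R := (z.2 - mu) ^+ 2 / (s ^+ 2 *+ 2)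
  - (z.2 - channel_mean mu r z.1) ^+ 2 / (tau ^+ 2 *+ 2).

(** The conditional density of the output divided by its marginal density. *)
Let g (z : R * R) : R := s / tau * expR (expo z).

Let measurable_mean : measurable_fun setT
  (fun z : R * R => (z.2 - channel_mean mu r z.1) ^+ 2).
Proof.
apply: measurable_funX; apply: measurable_funB => //.
apply: measurable_funD => //; apply: measurable_funM => //.
exact: measurable_funB.
Qed.

Let measurable_dev : measurable_fun setT (fun z : R * R => (z.2 - mu) ^+ 2).
Proof. by apply: measurable_funX; exact: measurable_funB. Qed.

Let g_gt0 z : 0 < g z.
Proof. by rewrite mulr_gt0 ?expR_gt0 // divr_gt0. Qed.

Let measurable_invg : measurable_fun setT (fun z => (g z)^-1).
Proof.
have -> : (fun z => (g z)^-1) = (fun z => (s / tau)^-1 * expR (- expo z)).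
  by apply/funext => z; rewrite /g invfM expRN.
apply: measurable_funM => //; apply: measurableT_comp => //.
apply: measurableT_comp => //.
by apply: measurable_funB; exact: measurable_funM.
Qed.

(** Dividing the channel density by [g] leaves the density of [N(mu, s^2)]: the inner integral no
    longer depends on the input, and the two coordinates decouple. *)
Let integral_invg (A B : set R) : measurable A -> measurable B ->
  (\int[channel_joint]_(z in fst @^-1` A `&` snd @^-1` B) ((g z)^-1)%:E =
   normal_prob mu s A * normal_prob mu s B)%E.
Proof.
move=> mA mB.
pose f (z : R * R) : \bar R := (\1_A z.1 * (\1_B z.2 * (g z)^-1))%:E.
have mf : measurable_fun setT f.
  apply/measurable_EFinP; apply: measurable_funM.
    by apply: measurableT_comp => //; exact: measurable_indic.
  apply: measurable_funM => //.
  by apply: measurableT_comp => //; exact: measurable_indic.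
have f0 z : (0 <= f z)%E.
  by rewrite lee_fin !mulr_ge0 // invr_ge0 ltW.
rewrite integral_mkcond.
transitivity (\int[channel_joint]_z f z)%E.
  apply: eq_integral => z _; rewrite patchE /f !indicE in_setI.
  rewrite -[z \in fst @^-1` A]/(z.1 \in A) -[z \in snd @^-1` B]/(z.2 \in B).
  by case: (z.1 \in A); case: (z.2 \in B); rewrite /= ?mul1r ?mul0r.
rewrite /channel_joint integral_source_joint //.
have inner x : (\int[channel mu s r x]_y f (x, y) =
    (\1_A x)%:E * normal_prob mu s B)%E.
  have mfx : measurable_fun setT (fun y => f (x, y)) by exact: measurableT_comp.
  have fx0 y : (0 <= f (x, y))%E by exact: f0.
  rewrite -(ge0_integral_normal_law _ _ mfx fx0) (ge0_integral_normal _ _ mfx fx0).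
  rewrite /normal_prob [in RHS]integral_mkcond -ge0_integralZl //=.
  - apply: eq_integral => y _; rewrite /f patchE indicE [\1_B _]indicE -EFinM.
    have -> : normal_pdf (channel_mean mu r x) (channel_dev s r) y =
        normal_pdf mu s y * g (x, y).
      by rewrite (normal_pdf_ratio mu _ y s_gt0 tau_gt0) /g /expo [RHS]mulrA.
    case: (y \in B) => /=; last by rewrite mul0r mulr0 mul0r mule0.
    rewrite -EFinM; congr EFin; rewrite mul1r.
    by field; rewrite gt_eqF.
  - apply/(measurable_restrictT _ _).1 => //; apply: measurable_funTS.
    by apply/measurable_EFinP; exact: measurable_normal_pdf.
  - by move=> y _; rewrite patchE; case: ifP => // _; rewrite lee_fin normal_pdf_ge0.
under eq_integral do rewrite inner.
have mi : measurable_fun setT (fun x : R => (\1_A x)%:E : \bar R).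
  by apply/measurable_EFinP; exact: measurable_indic.
rewrite ge0_integralZr //=.
by rewrite integral_indic // setIT.
Qed.

Let ln_gE z : ln (g z) = ln (s / tau) + expo z.
Proof. by rewrite /g [LHS]lnM ?posrE ?expR_gt0 ?divr_gt0 // expRK. Qed.

Let integral_dev : (\int[channel_joint]_z ((z.2 - mu) ^+ 2)%:E = (s ^+ 2)%:E)%E.
Proof.
rewrite /channel_joint integral_source_joint //.
- rewrite (channel_invariant mu s_gt0 r_ge0 r_lt1 (h := fun y => ((y - mu) ^+ 2)%:E)).
  + exact: normal_second_moment.
  + by apply/measurable_EFinP; exact: measurable_sqrB.
  + by move=> y; rewrite lee_fin sqr_ge0.
- exact/measurable_EFinP.
- by move=> z; rewrite lee_fin sqr_ge0.
Qed.

Let integral_mean : (\int[channel_joint]_z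
  ((z.2 - channel_mean mu r z.1) ^+ 2)%:E = (tau ^+ 2)%:E)%E.
Proof.
rewrite /channel_joint integral_source_joint //.
- rewrite (eq_integral (cst (tau ^+ 2)%:E)).
    rewrite integral_cst //.
    by rewrite [X in (_ * X)%E](@probability_setT _ _ _ (normal_prob mu s)) mule1.
  move=> x _ /=; rewrite -ge0_integral_normal_law.
  + exact: normal_second_moment.
  + by apply/measurable_EFinP; exact: measurable_sqrB.
  + by move=> y; rewrite lee_fin sqr_ge0.
- exact/measurable_EFinP.
- by move=> z; rewrite lee_fin sqr_ge0.
Qed.

(** The map [iota] relabels the output: it is the identity for [phi], and for [varphi] the passage
    to the copy of the line used as auxiliary space. *)
Lemma channel_mutinfo_le d (T : measurableType d) (iota : R -> T)
    (J : set R -> set T -> \bar R) : measurable_fun setT iota ->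
  (forall A B, measurable A -> measurable B ->
    J A B = (\int[normal_prob mu s]_(x in A) channel mu s r x (iota @^-1` B))%E) ->
  (mutinfo J <= (log2 (s / tau))%:E)%E.
Proof.
move=> miota JE.
have mpre B : measurable B -> measurable (iota @^-1` B).
  by move=> mB; rewrite -[X in measurable X]setTI; exact: miota.
have i1 : channel_joint.-integrable setT (fun z => ((z.2 - mu) ^+ 2)%:E).
  apply/integrableP; split; first exact/measurable_EFinP.
  under eq_integral do rewrite gee0_abs ?lee_fin ?sqr_ge0 //.
  by rewrite integral_dev ltry.
have i2 : channel_joint.-integrable setT
    (fun z => ((z.2 - channel_mean mu r z.1) ^+ 2)%:E).
  apply/integrableP; split; first exact/measurable_EFinP.
  under eq_integral do rewrite gee0_abs ?lee_fin ?sqr_ge0 //.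
  by rewrite integral_mean ltry.
have i1' : channel_joint.-integrable setT
    (EFin \o (fun z => (z.2 - mu) ^+ 2 / (s ^+ 2 *+ 2))).
  by rewrite /comp; under eq_fun do rewrite EFinM; exact: integrableZr.
have i2' : channel_joint.-integrable setT
    (EFin \o (fun z => (z.2 - channel_mean mu r z.1) ^+ 2 / (tau ^+ 2 *+ 2))).
  by rewrite /comp; under eq_fun do rewrite EFinM; exact: integrableZr.
have i3 : channel_joint.-integrable setT (EFin \o expo).
  by have := integrableB measurableT i1' i2'.
have i4 : channel_joint.-integrable setT (EFin \o (cst (ln (s / tau)) : R * R -> R)).
  exact: finite_measure_integrable_cst.
(* Both quadratic terms of [expo] have mean one half and cancel. *)
have Elng : \int[channel_joint]_z ln (g z) = ln (s / tau).
  under eq_Rintegral do rewrite ln_gE.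
  rewrite RintegralD // RintegralB // RintegralZr // RintegralZr //.
  rewrite Rintegral_cst // /Rintegral integral_dev integral_mean /=.
  have -> : fine (channel_joint setT) = 1 by rewrite /channel_joint probability_setT.
  by field; rewrite !gt_eqF.
rewrite /log2 -Elng.
apply: (@mutinfo_le_density _ _ _ _ _ _ R channel_joint fst (iota \o snd)) => //.
- exact: measurableT_comp.
- by move=> A B mA mB; rewrite JE // -(source_joint_rectangle mu s K mA (mpre _ mB)) //.
- rewrite (_ : _ \o _ = EFin \o (fun z => ln (s / tau) + expo z)).
    by have := integrableD measurableT i4 i3.
  by apply/funext => z /=; rewrite ln_gE.
- apply/integrableP; split; first exact/measurable_EFinP.
  under eq_integral do rewrite gee0_abs ?lee_fin ?invr_ge0 ?(ltW (g_gt0 _)) //.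
  have := integral_invg measurableT measurableT; rewrite !preimage_setT setIT => ->.
  by rewrite -ge0_fin_numE ?fin_numM ?fin_num_measure // mule_ge0.
- move=> A B mA mB; have mB' := mpre _ mB.
  rewrite /Rintegral [(iota \o snd) @^-1` B]comp_preimage integral_invg //.
  rewrite fineM ?fin_num_measure //.
  by congr (fine _ * fine _); apply/esym; [exact: source_joint_fst|exact: channel_joint2].
Qed.

End channel_information.

(** * Markov chains through an auxiliary variable *)

Lemma integral_indic_setT d (T : measurableType d) (R : realType)
    (mu : {measure set T -> \bar R}) (A : set T) : measurable A ->
  (\int[mu]_x (\1_A x)%:E = mu A)%E.
Proof. by move=> mA; rewrite integral_indic // setIT. Qed.

(** When the right side is infinite there is nothing to prove, whatever default [m] has received.
    Otherwise [y] is square integrable, [m] is its true mean, and the cross term integrates to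
    zero. *)
Lemma bias_variance_le (R : realType) (Q : probability R R) (x m : R) :
  m = fine (\int[Q]_y y%:E)%E ->
  (((x - m) ^+ 2)%:E + \int[Q]_y ((y - m) ^+ 2)%:E
    <= \int[Q]_y ((x - y) ^+ 2)%:E)%E.
Proof.
move=> mE; have [fin|] := ltP (\int[Q]_y ((x - y) ^+ 2)%:E)%E +oo%E; last first.
  by rewrite leye_eq => /eqP ->; exact: leey.
have ic (a : R) : Q.-integrable setT (EFin \o (cst a : R -> R)).
  exact: finite_measure_integrable_cst.
have mB : measurable_fun setT (fun y : R => x - y) by exact: measurable_funB.
have ixy : Q.-integrable setT (fun y => ((x - y) ^+ 2)%:E).
  apply/integrableP; split; first by apply/measurable_EFinP; exact: measurable_funX.
  by under eq_integral do rewrite gee0_abs ?lee_fin ?sqr_ge0 //.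
have iy2 : Q.-integrable setT (fun y => (y ^+ 2)%:E).
  have -> : (fun y : R => (y ^+ 2)%:E) = (fun y => ((x - (x - y)) ^+ 2)%:E).
    by apply/funext => y; congr ((_ ^+ 2)%:E); ring.
  apply: integrable_sqrB => //; exact: ic.
have iy : Q.-integrable setT (EFin \o (fun y : R => y)).
  pose h (y : R) : \bar R := (1%:E + (y ^+ 2)%:E)%E.
  apply: (le_integrable measurableT (g := h)); first exact/measurable_EFinP.
    move=> y _; rewrite /h -EFinD lee_fin [leRHS]ger0_norm ?addr_ge0 ?sqr_ge0 //.
    by rewrite ler_norml; apply/andP; split; nra.
  by apply: integrableD => //; exact: ic.
have im : Q.-integrable setT (EFin \o (fun y => (y - m) ^+ 2)).
  by apply: (integrable_sqrB (g := cst m)) => //; exact: (ic (m ^+ 2)).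
have iym : Q.-integrable setT (EFin \o (fun y => y - m)).
  by have := integrableB measurableT iy (ic m).
have il : Q.-integrable setT (EFin \o (fun y => 2 * (m - x) * (y - m))).
  by rewrite /comp; under eq_fun do rewrite EFinM; exact: integrableZl.
have izl : Q.-integrable setT (EFin \o (fun y => (x - m) ^+ 2 + (y - m) ^+ 2)).
  by have := integrableD measurableT (ic ((x - m) ^+ 2)) im.
have QT : fine (Q setT) = 1 by rewrite probability_setT.
rewrite -[X in (_ + X <= _)%E]fineK ?integrable_fin_num //.
rewrite -[leRHS]fineK ?integrable_fin_num // -EFinD lee_fin.
rewrite -[leRHS]/(\int[Q]_y ((x - y) ^+ 2)).
have -> : \int[Q]_y ((x - y) ^+ 2) =
    \int[Q]_y (((x - m) ^+ 2 + (y - m) ^+ 2) + 2 * (m - x) * (y - m)).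
  by apply: eq_Rintegral => y _; ring.
rewrite RintegralD // RintegralZl // RintegralB //; last exact: ic.
rewrite RintegralD //; last exact: ic.
rewrite !Rintegral_cst // QT !mulr1.
by rewrite /Rintegral -mE subrr mulr0 addr0.
Qed.

Section markov_chain.
Context (R : realType) d (U : measurableType d).
Variables (k1 : R.-pker R ~> U) (k2 : R.-pker U ~> R).
Variables (mu s : R).

(** Ignoring the first coordinate is the Markov property. *)
Definition chain_output (z : R * U) : {measure set R -> \bar R} := k2 z.2.

Let measurable_chain_output B : measurable B ->
  measurable_fun setT (chain_output ^~ B).
Proof.
by move=> mB; exact: (measurableT_comp (measurable_kernel k2 _ mB) measurable_snd).
Qed.

HB.instance Definition _ :=
  @isKernel.Build _ _ _ _ R chain_output measurable_chain_output.

Let chain_outputT z : chain_output z setT = 1%E.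
Proof. exact: prob_kernel. Qed.

HB.instance Definition _ :=
  @Kernel_isProbability.Build _ _ _ _ R chain_output chain_outputT.

Definition chain_law : set ((R * U) * R) -> \bar R :=
  kernel_prod (kernel_prod (normal_law mu s) k1) chain_output.

HB.instance Definition _ := Probability.on chain_law.

Lemma integral_chain_law (f : R * U * R -> \bar R) : measurable_fun setT f ->
  (forall z, 0 <= f z)%E ->
  (\int[chain_law]_z f z =
   \int[normal_prob mu s]_x \int[k1 x]_u \int[k2 u]_y f (x, u, y))%E.
Proof.
move=> mf f0; rewrite integral_kernel_prod //.
have m1 := measurable_kfcomp chain_output mf f0.
have p1 z : (0 <= kfcomp chain_output f z)%E.
  by apply: integral_ge0 => y _; exact: f0.
rewrite (integral_kernel_prod (normal_law mu s) k1 m1 p1).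
rewrite ge0_integral_normal_law //.
  exact: (measurable_kfcomp k1 m1 p1).
by move=> x; apply: integral_ge0 => u _; exact: p1.
Qed.

Lemma chain_law_XU (A : set R) (B : set U) : measurable A -> measurable B ->
  (chain_law ((fun w => w.1.1) @^-1` A `&` (fun w => w.1.2) @^-1` B) =
   \int[normal_prob mu s]_(x in A) k1 x B)%E.
Proof.
move=> mA mB.
have mS : measurable ((fun w : R * U * R => w.1.1) @^-1` A
    `&` (fun w => w.1.2) @^-1` B).
  apply: measurableI; rewrite -[X in measurable X]setTI.
    have m11 : measurable_fun setT (fun w : R * U * R => w.1.1) by exact: measurableT_comp.
    exact: m11.
  have m12 : measurable_fun setT (fun w : R * U * R => w.1.2) by exact: measurableT_comp.
  exact: m12.
rewrite -integral_indic_setT // integral_chain_law; last 2 first.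
- by apply/measurable_EFinP; exact: measurable_indic.
- by move=> z; rewrite lee_fin.
rewrite [RHS]integral_mkcond; apply: eq_integral => x _; rewrite patchE.
under eq_integral => u _.
  under eq_integral => y _.
    rewrite indicE in_setI.
    rewrite -[_ \in (fun w => w.1.1) @^-1` A]/(x \in A).
    rewrite -[_ \in (fun w => w.1.2) @^-1` B]/(u \in B).
    over.
  rewrite integral_cst // [X in (_ * X)%E]prob_kernel mule1; over.
case: ifP => xA /=; last by rewrite integral0.
exact: integral_indic_setT.
Qed.

Lemma chain_law_YU (C : set R) (B : set U) : measurable C -> measurable B ->
  (chain_law (snd @^-1` C `&` (fun w => w.1.2) @^-1` B) =
   \int[normal_prob mu s]_x \int[k1 x]_(u in B) k2 u C)%E.
Proof.
move=> mC mB.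
have mS : measurable ((snd : R * U * R -> R) @^-1` C
    `&` (fun w => w.1.2) @^-1` B).
  apply: measurableI; rewrite -[X in measurable X]setTI.
    exact: measurable_snd.
  have m12 : measurable_fun setT (fun w : R * U * R => w.1.2) by exact: measurableT_comp.
  exact: m12.
rewrite -integral_indic_setT // integral_chain_law; last 2 first.
- by apply/measurable_EFinP; exact: measurable_indic.
- by move=> z; rewrite lee_fin.
apply: eq_integral => x _.
rewrite [RHS]integral_mkcond; apply: eq_integral => u _; rewrite patchE.
under eq_integral => y _.
  rewrite indicE in_setI andbC.
  rewrite -[_ \in snd @^-1` C]/(y \in C).
  rewrite -[_ \in (fun w => w.1.2) @^-1` B]/(u \in B).
  over.
case: ifP => uB /=; last by rewrite integral0.
exact: integral_indic_setT.
Qed.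

(** The default given by [fine] to a mean that is not finite is harmless: the inner distortion
    integral at such a [u] is infinite. *)
Definition chain_mean (u : U) : R := fine (\int[k2 u]_y y%:E)%E.

Lemma measurable_chain_mean : measurable_fun setT chain_mean.
Proof.
apply: (measurableT_comp (fine_measurable _)) => //.
under eq_fun do rewrite integralE.
have mE : measurable_fun setT (fun y : R => y%:E : \bar R) by exact/measurable_EFinP.
apply: emeasurable_funB; apply: measurable_fun_integral_kernel => //.
- by move=> B; exact: measurable_kernel.
- exact: measurable_funepos.
- by move=> B; exact: measurable_kernel.
- exact: measurable_funeneg.
Qed.

(** Given [(x, u)] the output has law [k2 u] whatever [x] is, so the bias-variance inequality
    applies at each such pair with the same center [chain_mean u]. *)
Lemma chain_distortion_split :
  (\int[chain_law]_w ((w.1.1 - chain_mean w.1.2) ^+ 2)%:E +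
   \int[chain_law]_w ((w.2 - chain_mean w.1.2) ^+ 2)%:E <=
   \int[normal_prob mu s]_x \int[k1 x]_u \int[k2 u]_y ((x - y) ^+ 2)%:E)%E.
Proof.
have mm : measurable_fun setT (fun w : R * U * R => chain_mean w.1.2).
  apply: (measurableT_comp measurable_chain_mean).
  exact: measurableT_comp.
have m11 : measurable_fun setT (fun w : R * U * R => w.1.1) by exact: measurableT_comp.
have mf1 : measurable_fun setT
    (fun w : R * U * R => ((w.1.1 - chain_mean w.1.2) ^+ 2)%:E).
  by apply/measurable_EFinP; apply: measurable_funX; exact: measurable_funB.
have mf2 : measurable_fun setT
    (fun w : R * U * R => ((w.2 - chain_mean w.1.2) ^+ 2)%:E).
  by apply/measurable_EFinP; apply: measurable_funX; exact: measurable_funB.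
have sq0 (a : R) : (0 <= (a ^+ 2)%:E)%E by rewrite lee_fin sqr_ge0.
rewrite -ge0_integralD // -[X in (_ <= X)%E](integral_chain_law
  (f := fun w => ((w.1.1 - w.2) ^+ 2)%:E)) //; last first.
  by apply/measurable_EFinP; apply: measurable_funX; exact: measurable_funB.
have mf3 : measurable_fun setT (fun w : R * U * R => ((w.1.1 - w.2) ^+ 2)%:E).
  by apply/measurable_EFinP; apply: measurable_funX; exact: measurable_funB.
rewrite integral_kernel_prod; [|exact: emeasurable_funD|by move=> z; rewrite adde_ge0].
rewrite [X in (_ <= X)%E]integral_kernel_prod //.
apply: ge0_le_integral => //.
- by move=> z _; apply: integral_ge0 => y _; rewrite adde_ge0.
- exact: (measurable_kfcomp chain_output (emeasurable_funD mf1 mf2)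
    (fun z => adde_ge0 (sq0 _) (sq0 _))).
- exact: (measurable_kfcomp chain_output mf3 (fun z => sq0 _)).
move=> [x u] _ /=; rewrite ge0_integralD //.
- rewrite integral_cst // [X in (_ * X + _)%E]chain_outputT mule1.
  exact: (bias_variance_le (Q := kernel_at k2 u) x erefl).
- by apply/measurable_EFinP; exact: measurable_sqrB.
Qed.

End markov_chain.

Section lower_bounds.
Context (R : realType).
Variables (mu s : R).
Hypothesis s_gt0 : 0 < s.

(** With [a = X - mu] and [b = Y - mu], one has [(a - rho b)^2 = (1 - rho) a^2 - rho (1 - rho) b^2 +
    rho (a - b)^2]. The covariance is thus expressed through the distortion and the two marginal
    second moments, both equal to [s^2]. *)
Lemma phi_feasible_mutinfo_ge (D del rho : R) (k : R.-pker R ~> R) :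
  phi_feasible mu s D k -> 0 < del -> del < s -> 0 <= rho <= 1 ->
  s ^+ 2 * (1 - rho) ^+ 2 + rho * D <= del ^+ 2 ->
  ((log2 (s / del))%:E <= mutinfo (joint_XXh mu s k))%E.
Proof.
move=> [distD marg] del0 dels /andP[rho0 rho1] le_del.
pose M : probability (R * R)%type R := source_joint mu s k.
have law1 A : measurable A -> M (fst @^-1` A) = normal_prob mu s A.
  exact: source_joint_fst.
have law2 C : measurable C -> M (snd @^-1` C) = normal_prob mu s C.
  move=> mC; rewrite -marg // /joint_XXh -source_joint_rectangle //.
  by rewrite preimage_setT setTI.
pose v (y : R) := mu + rho * (y - mu).
have mv : measurable_fun setT v.
  by apply: measurable_funD => //; apply: measurable_funM => //; exact: measurable_funB.
apply: (mutinfo_ge_estimator (P := M) measurable_fst measurable_snd s_gt0 law1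
  _ mv del0 dels).
  by move=> A B mA mB; rewrite /joint_XXh -source_joint_rectangle.
have m12 : measurable_fun setT (fun z : R * R => (z.1 - z.2) ^+ 2).
  by apply: measurable_funX; exact: measurable_funB.
have dist : (\int[M]_z ((z.1 - z.2) ^+ 2)%:E <= D%:E)%E.
  rewrite integral_source_joint //; first exact/measurable_EFinP.
  by move=> z; rewrite lee_fin sqr_ge0.
have i1 := integrable_source_sqr measurable_fst s_gt0 law1 mu.
have i2 := integrable_source_sqr measurable_snd s_gt0 law2 mu.
have e1 := integral_source_sqr measurable_fst s_gt0 law1.
have e2 := integral_source_sqr measurable_snd s_gt0 law2.
have i12 : M.-integrable setT (fun z : R * R => ((z.1 - z.2) ^+ 2)%:E).
  apply/integrableP; split; first exact/measurable_EFinP.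
  under eq_integral do rewrite gee0_abs ?lee_fin ?sqr_ge0 //.
  by rewrite (le_lt_trans dist) // ltry.
have j1 : M.-integrable setT (EFin \o (fun z : R * R => (1 - rho) * (z.1 - mu) ^+ 2)).
  by rewrite /comp; under eq_fun do rewrite EFinM; exact: integrableZl.
have j2 : M.-integrable setT
    (EFin \o (fun z : R * R => rho * (1 - rho) * (z.2 - mu) ^+ 2)).
  by rewrite /comp; under eq_fun do rewrite EFinM; exact: integrableZl.
have j3 : M.-integrable setT (EFin \o (fun z : R * R => rho * (z.1 - z.2) ^+ 2)).
  by rewrite /comp; under eq_fun do rewrite EFinM; exact: integrableZl.
have j12 : M.-integrable setT (EFin \o (fun z : R * R =>
    (1 - rho) * (z.1 - mu) ^+ 2 - rho * (1 - rho) * (z.2 - mu) ^+ 2)).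
  by have := integrableB measurableT j1 j2.
have j : M.-integrable setT (EFin \o (fun z : R * R =>
    (1 - rho) * (z.1 - mu) ^+ 2 - rho * (1 - rho) * (z.2 - mu) ^+ 2
    + rho * (z.1 - z.2) ^+ 2)).
  by have := integrableD measurableT j12 j3.
have -> : (fun z : R * R => ((z.1 - v z.2) ^+ 2)%:E) = (EFin \o (fun z : R * R =>
    (1 - rho) * (z.1 - mu) ^+ 2 - rho * (1 - rho) * (z.2 - mu) ^+ 2
    + rho * (z.1 - z.2) ^+ 2)).
  by apply/funext => z /=; congr EFin; rewrite /v; ring.
rewrite -[leLHS]fineK ?integrable_fin_num // lee_fin -[leLHS]/(Rintegral _ _ _).
rewrite RintegralD // RintegralB // !RintegralZl //.
have -> : \int[M]_z ((z.1 - mu) ^+ 2) = s ^+ 2 by rewrite /Rintegral e1.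
have -> : \int[M]_z ((z.2 - mu) ^+ 2) = s ^+ 2 by rewrite /Rintegral e2.
have d : \int[M]_z ((z.1 - z.2) ^+ 2) <= D.
  by rewrite -lee_fin [leLHS]fineK ?integrable_fin_num.
apply: le_trans le_del; have := ler_wpM2l rho0 d; lra.
Qed.

Lemma varphi_feasible_value_ge (U : completePseudoMetricType R) (D del : R)
    (k1 : R.-pker R ~> borelU U) (k2 : R.-pker borelU U ~> R) :
  varphi_feasible mu s D k1 k2 -> 0 < del -> del < s ->
  D / 2 <= del ^+ 2 ->
  ((log2 (s / del))%:E <= varphi_value mu s k1 k2)%E.
Proof.
move=> [distD marg] del0 dels le_del.
pose M : probability (R * borelU U * R)%type R := chain_law k1 k2 mu s.
have m11 : measurable_fun setT (fun w : R * borelU U * R => w.1.1).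
  exact: measurableT_comp.
have m12 : measurable_fun setT (fun w : R * borelU U * R => w.1.2).
  exact: measurableT_comp.
have law1 A : measurable A -> M ((fun w => w.1.1) @^-1` A) = normal_prob mu s A.
  move=> mA; have := chain_law_XU k1 k2 mu s mA measurableT.
  rewrite preimage_setT setIT => e; apply: (etrans e).
  rewrite (eq_integral (cst 1%E)) ?integral_cst ?mul1e //.
  by move=> x _; exact: prob_kernel.
have law2 C : measurable C -> M (snd @^-1` C) = normal_prob mu s C.
  move=> mC; have := chain_law_YU k1 k2 mu s mC measurableT.
  by rewrite preimage_setT setIT => e; apply: (etrans e); exact: marg.
have split := le_trans (chain_distortion_split k1 k2 mu s) distD.
have sq0 (f : R * borelU U * R -> R) : (0 <= \int[M]_w (f w ^+ 2)%:E)%E.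
  by apply: integral_ge0 => w _; rewrite lee_fin sqr_ge0.
have [le1|gt1] := leP (\int[M]_w ((w.1.1 - chain_mean k2 w.1.2) ^+ 2)%:E)%E
    (D / 2)%:E.
  rewrite /varphi_value le_max; apply/orP; left.
  apply: (mutinfo_ge_estimator (P := M) m11 m12 s_gt0 law1 _
    (measurable_chain_mean k2) del0 dels).
    by move=> A B mA mB; apply/esym; exact: chain_law_XU.
  by apply: le_trans le1 _; rewrite lee_fin.
(* Otherwise the output plays the source: feasibility gives it the law [N(mu, s^2)]. *)
rewrite /varphi_value le_max; apply/orP; right.
apply: (mutinfo_ge_estimator (P := M) measurable_snd m12 s_gt0 law2 _
  (measurable_chain_mean k2) del0 dels).
  by move=> A B mA mB; apply/esym; exact: chain_law_YU.
have le2 : (\int[M]_w ((w.2 - chain_mean k2 w.1.2) ^+ 2)%:E <= (D / 2)%:E)%E.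
  move: (sq0 (fun w => w.1.1 - chain_mean k2 w.1.2))
    (sq0 (fun w => w.2 - chain_mean k2 w.1.2)) split gt1.
  case: (integral _ _ _) => [a| |] //; case: (integral _ _ _) => [b| |] //.
  by rewrite -EFinD !lee_fin lte_fin => a0 b0 ab aD; lra.
by apply: le_trans le2 _; rewrite lee_fin.
Qed.

Lemma log2_unbounded (m : \bar R) :
  (forall del, 0 < del -> del < s -> ((log2 (s / del))%:E <= m)%E) -> m = +oo%E.
Proof.
move=> h; have l2 := ln2_gt0 R.
have key a : 0 < a -> (a%:E <= m)%E.
  (* With [del = s * 2^-a] the lower bound is exactly [a]. *)
  move=> a0; pose e := expR (- (a * ln 2)).
  have e0 : 0 < e by exact: expR_gt0.
  have e1 : e < 1 by rewrite -expR0 ltr_expR oppr_lt0 mulr_gt0.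
  have := h (s * e); rewrite mulr_gt0 // gtr_pMr // => /(_ isT e1).
  suff -> : log2 (s / (s * e)) = a by [].
  rewrite invfM mulrA divff ?gt_eqF // mul1r /log2 lnV ?posrE // expRK opprK.
  by rewrite mulfK // gt_eqF.
case: m h key => [x| |] // _ key; last by have := key 1 ltr01.
have := key (`|x| + 1); rewrite ltr_wpDl // => /(_ isT).
rewrite lee_fin leNgt (le_lt_trans (ler_norm x)) // ltrDl.
exact: ltr01.
Qed.

End lower_bounds.

(** * Attaining the bounds *)

Section borel_line.
Context (R : realType).

Definition line : completePseudoMetricType R := R.

Lemma polish_line : polish line.
Proof.
split; first exact: Rhausdorff.
exists (range (@ratr R)); split.
  exact: (card_le_trans (card_image_le _ _) (countableP _)).
apply/seteqP; split => // x _ A Ax.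
have [y [Ay Qy]] : (A^° `&` range (@ratr R)) !=set0.
  by apply: dense_rat; [exists x; exact: Ax|exact: open_interior].
by exists y; split => //; exact: interior_subset Ay.
Qed.

(** The identity between two presentations of the Borel sets of the line; measurability has to be
    proved in each direction. *)
Definition to_borel : R -> borelU line := id.
Definition of_borel : borelU line -> R := id.

Lemma measurable_to_borel : measurable_fun setT to_borel.
Proof.
apply: (@measurability _ _ _ _ setT to_borel (@open line)) => //.
by move=> _ [A oA <-]; rewrite setTI; exact: open_measurable.
Qed.

Lemma measurable_of_borel : measurable_fun setT of_borel.
Proof.
apply: (measurability _ (RGenOInfty.measurableE R)) => // _ [_ [x ->] <-].
by rewrite setTI; apply: sub_sigma_algebra; exact: rray_open.
Qed.

End borel_line.

Section upper_bounds.
Context (R : realType).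
Variables (mu s r : R).

Definition encoder (x : R) : {measure set (borelU (line R)) -> \bar R} :=
  giry_map (@measurable_to_borel R) (kernel_at (channel mu s r) x).

Definition decoder (u : borelU (line R)) : {measure set R -> \bar R} :=
  channel mu s r (of_borel u).

Let mpre B : measurable B -> measurable (@to_borel R @^-1` B).
Proof.
by move=> mB; rewrite -[X in measurable X]setTI; exact: measurable_to_borel.
Qed.

Let measurable_encoder B : measurable B -> measurable_fun setT (encoder ^~ B).
Proof. by move=> mB; exact: (measurable_kernel (channel mu s r) _ (mpre mB)). Qed.

HB.instance Definition _ :=
  @isKernel.Build _ _ _ _ R encoder measurable_encoder.

Let encoderT x : encoder x setT = 1%E.
Proof. exact: (prob_kernel (s := channel mu s r)). Qed.

HB.instance Definition _ :=
  @Kernel_isProbability.Build _ _ _ _ R encoder encoderT.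

Let measurable_decoder B : measurable B -> measurable_fun setT (decoder ^~ B).
Proof.
move=> mB; exact: (measurableT_comp (measurable_kernel (channel mu s r) _ mB)
  (@measurable_of_borel R)).
Qed.

HB.instance Definition _ :=
  @isKernel.Build _ _ _ _ R decoder measurable_decoder.

Let decoderT u : decoder u setT = 1%E.
Proof. exact: (prob_kernel (s := channel mu s r)). Qed.

HB.instance Definition _ :=
  @Kernel_isProbability.Build _ _ _ _ R decoder decoderT.

Hypotheses (s_gt0 : 0 < s) (r_ge0 : 0 <= r) (r_lt1 : r < 1).

Let tau : R := channel_dev s r.
Let K : R.-pker R ~> R := channel mu s r.

Lemma phi_le (D : R) : s ^+ 2 * (1 - r) *+ 2 <= D ->
  (phi mu s D <= (log2 (s / tau))%:E)%E.
Proof.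
move=> leD; apply: (@le_trans _ _ (mutinfo (joint_XXh mu s K))).
  apply: ereal_inf_lbound; exists K => //; split.
    by rewrite (channel_distortion mu s_gt0 r_ge0 r_lt1) lee_fin.
  by move=> C mC; exact: (channel_marginal mu s_gt0 r_ge0 r_lt1).
exact: (channel_mutinfo_le (mu := mu) s_gt0 r_ge0 r_lt1 (iota := id)).
Qed.

Lemma integral_encoder x (h : R -> \bar R) : measurable_fun setT h ->
  (forall u, 0 <= h u)%E ->
  (\int[encoder x]_u h (of_borel u) = \int[channel mu s r x]_u h u)%E.
Proof.
move=> mh h0.
have mh' : measurable_fun setT (h \o @of_borel R).
  exact: (measurableT_comp mh (@measurable_of_borel R)).
have := ge0_integral_pushforward (@measurable_to_borel R) (channel mu s r x)
  measurableT mh' (fun u _ => h0 u).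
by rewrite preimage_setT => e; exact: (etrans e).
Qed.

(** By invariance [U] has law [N(mu, s^2)]; by reversibility, drawing the output from [U] amounts to
    drawing [U] from the output through the same channel. Both informations in [varphi_value] are
    therefore bounded alike. *)
Lemma joint_XhU_channel (C : set R) (B : set (borelU (line R))) :
  measurable C -> measurable B ->
  joint_XhU mu s encoder decoder C B =
  (\int[normal_prob mu s]_(x in C) channel mu s r x (@to_borel R @^-1` B))%E.
Proof.
move=> mC mB; have mB' := mpre mB; rewrite /joint_XhU.
have mK : measurable_fun setT (fun u : R => channel mu s r u C).
  exact: (measurable_kernel K).
pose h (u : R) : \bar R := ((\1_(@to_borel R @^-1` B) u)%:E * channel mu s r u C)%E.
have mh : measurable_fun setT h.
  by apply: emeasurable_funM => //; apply/measurable_EFinP; exact: measurable_indic.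
have h0 u : (0 <= h u)%E by rewrite mule_ge0 // lee_fin.
transitivity (\int[normal_prob mu s]_x \int[channel mu s r x]_u h u)%E.
  apply: eq_integral => x _; rewrite -integral_encoder // integral_mkcond.
  apply: eq_integral => u _; rewrite patchE /h indicE.
  rewrite -[of_borel u \in _]/(u \in B).
  by case: (u \in B); rewrite ?mul1e ?mul0e.
rewrite (channel_invariant mu s_gt0 r_ge0 r_lt1) //.
pose f (z : R * R) : \bar R :=
  ((\1_(@to_borel R @^-1` B) z.1)%:E * (\1_C z.2)%:E)%E.
have mf : measurable_fun setT f.
  by apply: emeasurable_funM; apply/measurable_EFinP; apply: measurableT_comp => //;
    exact: measurable_indic.
have f0 z : (0 <= f z)%E by rewrite mule_ge0 // lee_fin.
transitivity (\int[normal_prob mu s]_x \int[channel mu s r x]_y f (x, y))%E.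
  apply: eq_integral => x _; rewrite /f /= ge0_integralZl //=.
    by rewrite integral_indic_setT.
  by apply/measurable_EFinP; exact: measurable_indic.
rewrite (channel_reversible mu s_gt0 r_ge0 r_lt1 mf f0) [RHS]integral_mkcond.
apply: eq_integral => y _; rewrite patchE /f /= indicE.
case: (y \in C); last by under eq_integral do rewrite mule0; rewrite integral0.
by under eq_integral do rewrite mule1; rewrite integral_indic_setT.
Qed.

Lemma varphi_le (D : R) : s ^+ 2 * (1 - r ^+ 2) *+ 2 <= D ->
  (varphi mu s D <= (log2 (s / tau))%:E)%E.
Proof.
move=> leD; have t0 := channel_dev_gt0 s_gt0 r_ge0 r_lt1.
apply: (@le_trans _ _ (varphi_value mu s encoder decoder)); last first.
  rewrite /varphi_value ge_max; apply/andP; split.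
    exact: (channel_mutinfo_le (mu := mu) s_gt0 r_ge0 r_lt1
      (@measurable_to_borel R)).
  apply: (channel_mutinfo_le (mu := mu) s_gt0 r_ge0 r_lt1
      (@measurable_to_borel R)) => C B mC mB.
  exact: joint_XhU_channel.
apply: ereal_inf_lbound; exists (line R), encoder, decoder; split => //.
  exact: polish_line.
split; last first.
  move=> C mC; rewrite joint_XhU_channel // preimage_setT.
  rewrite (eq_integral (cst 1%E)) ?integral_cst ?mul1e //.
have mB x : measurable_fun setT (fun y : R => ((x - y) ^+ 2)%:E).
  by apply/measurable_EFinP; apply: measurable_funX; exact: measurable_funB.
have B0 x y : (0 <= ((x - y) ^+ 2 : R)%:E)%E by rewrite lee_fin sqr_ge0.
(* The mean of [(x - y)^2] given [u]: squared distance to the decoder mean plus the decoder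
   variance. *)
pose h (z : R * R) : \bar R :=
  (((z.1 - channel_mean mu r z.2) ^+ 2)%:E + (tau ^+ 2)%:E)%E.
have mh : measurable_fun setT h.
  apply: emeasurable_funD => //; apply/measurable_EFinP; apply: measurable_funX.
  apply: measurable_funB => //; apply: measurable_funD => //.
  by apply: measurable_funM => //; exact: measurable_funB.
have h0 z : (0 <= h z)%E by rewrite adde_ge0 // lee_fin sqr_ge0.
have hE x u : (\int[channel mu s r u]_y ((x - y) ^+ 2)%:E = h (x, u))%E.
  by rewrite -(ge0_integral_normal_law _ _ (mB _) (B0 _)) integral_normal_sqrB.
have hE' u : (\int[channel mu s r u]_x h (x, u) = (tau ^+ 2 *+ 2)%:E)%E.
  have mh1 : measurable_fun setT (fun x : R => h (x, u)).
    exact: measurableT_comp.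
  rewrite -(ge0_integral_normal_law _ _ mh1 (fun x => h0 _)) /h ge0_integralD //=.
  - rewrite normal_second_moment // integral_cst //.
    rewrite [X in (_ + _ * X)%E](@probability_setT _ _ _ (normal_prob _ _)) mule1.
    by rewrite -EFinD mulr2n.
  - by apply/measurable_EFinP; exact: measurable_sqrB.
  - by move=> x _; rewrite lee_fin; exact: sqr_ge0.
suff -> : (\int[normal_prob mu s]_x \int[encoder x]_u \int[decoder u]_y
    ((x - y) ^+ 2)%:E = (tau ^+ 2 *+ 2)%:E)%E.
  by rewrite lee_fin (le_trans _ leD) // channel_dev2.
transitivity
    (\int[normal_prob mu s]_x \int[channel mu s r x]_u h (x, u))%E.
  apply: eq_integral => x _.
  rewrite -(integral_encoder x (h := fun u => h (x, u))) //.
    by apply: eq_integral => u _; exact: hE.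
  exact: measurableT_comp.
(* Read backwards, [x] given [u] is normal around the same center [channel_mean u], so input and
   output each contribute [tau^2]. *)
rewrite (channel_reversible mu s_gt0 r_ge0 r_lt1 mh h0).
under eq_integral do rewrite hE'.
rewrite integral_cst //.
by rewrite [X in (_ * X)%E](@probability_setT _ _ _ (normal_prob _ _)) mule1.
Qed.

End upper_bounds.

Lemma log2_sqr (R : realType) (x : R) : 0 < x -> log2 x = 2^-1 * log2 (x ^+ 2).
Proof.
move=> x0; rewrite /log2 expr2 lnM ?posrE //.
by field; rewrite gt_eqF // ln2_gt0.
Qed.

Theorem theorem8 (R : realType) (mu sigma : R) (hsigma : 0 < sigma) :
  [/\ phi mu sigma 0 = +oo%E,
      varphi mu sigma 0 = +oo%E,
      (forall D : R, 0 < D < 2 * sigma ^+ 2 ->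
         phi mu sigma D =
           (2^-1 * log2 (4 * sigma ^+ 4 / (4 * sigma ^+ 2 * D - D ^+ 2)))%:E /\
         varphi mu sigma D = (2^-1 * log2 (2 * sigma ^+ 2 / D))%:E)
    & (forall D : R, 2 * sigma ^+ 2 <= D ->
         phi mu sigma D = 0%E /\ varphi mu sigma D = 0%E)].
Proof.
have s2 : 0 < sigma ^+ 2 by rewrite exprn_gt0.
split.
- apply: (log2_unbounded hsigma) => del del0 dels.
  apply: le_ereal_inf_tmp => _ [k kD <-].
  (* With [rho = 1] the estimator is the reconstruction itself, whose error is at most [D = 0]. *)
  apply: (phi_feasible_mutinfo_ge hsigma (rho := 1) kD del0 dels).
    by rewrite ler01 lexx.
  by rewrite subrr expr0n mulr0 mulr0 addr0 sqr_ge0.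
- apply: (log2_unbounded hsigma) => del del0 dels.
  apply: le_ereal_inf_tmp => _ [U [k1 [k2 [_ kD ->]]]].
  apply: (varphi_feasible_value_ge hsigma kD del0 dels).
  by rewrite mul0r sqr_ge0.
- move=> D /andP[D0 D2].
  pose rho := 1 - D / (2 * sigma ^+ 2).
  have q0 : 0 < D / (2 * sigma ^+ 2) by rewrite divr_gt0 // mulr_gt0.
  have q1 : D / (2 * sigma ^+ 2) < 1 by rewrite ltr_pdivrMr ?mul1r // mulr_gt0.
  have rho0 : 0 < rho by rewrite subr_gt0.
  have rho1 : rho < 1 by rewrite ltrBlDr ltrDl.
  have DE : D = sigma ^+ 2 * (1 - rho) *+ 2.
    by rewrite /rho; field; rewrite gt_eqF.
  have dev_lt (r : R) : 0 < r -> r < 1 -> channel_dev sigma r < sigma.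
    move=> r0 r1; rewrite gtr_pMr // -[ltRHS]sqrtr1 ltr_sqrt // ltrBlDr ltrDl.
    by rewrite exprn_gt0.
  split.
    have t0 := channel_dev_gt0 hsigma (ltW rho0) rho1.
    have t2 := channel_dev2 sigma (ltW rho0) rho1.
    have -> : 2^-1 * log2 (4 * sigma ^+ 4 / (4 * sigma ^+ 2 * D - D ^+ 2)) =
        log2 (sigma / channel_dev sigma rho).
      rewrite [RHS]log2_sqr ?divr_gt0 // exprMn exprVn t2 DE.
      congr (_ * log2 _).
      have r2 : 0 < 1 - rho ^+ 2 by rewrite subr_gt0 expr_lt1 // ltW.
      have nz : 4 * sigma ^+ 2 * (sigma ^+ 2 * (1 - rho) * 2)
          - (sigma ^+ 2 * (1 - rho) * 2) ^+ 2 != 0.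
        rewrite (_ : _ - _ = 4 * sigma ^+ 4 * (1 - rho ^+ 2)); last by ring.
        by rewrite gt_eqF // !mulr_gt0.
      by field; rewrite nz !gt_eqF.
    apply/eqP; rewrite eq_le; apply/andP; split.
      by apply: phi_le => //; [exact: ltW|rewrite -DE].
    apply: le_ereal_inf_tmp => _ [k kD <-].
    apply: (phi_feasible_mutinfo_ge hsigma (rho := rho) kD t0).
    + exact: dev_lt.
    + by rewrite !ltW.
    (* The estimation error matches the channel variance: [(1 - rho)^2 + 2 rho (1 - rho) = 1 -
       rho^2]. *)
    + by rewrite t2 le_eqVlt; apply/orP; left; apply/eqP; rewrite DE; ring.
  have r0 : 0 < Num.sqrt rho by rewrite sqrtr_gt0.
  have r1 : Num.sqrt rho < 1 by rewrite -[ltRHS]sqrtr1 ltr_sqrt.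
  have t0 := channel_dev_gt0 hsigma (ltW r0) r1.
  have t2 := channel_dev2 sigma (ltW r0) r1.
  rewrite sqr_sqrtr ?(ltW rho0) // in t2.
  have -> : 2^-1 * log2 (2 * sigma ^+ 2 / D) =
      log2 (sigma / channel_dev sigma (Num.sqrt rho)).
    rewrite [RHS]log2_sqr ?divr_gt0 // exprMn exprVn t2 DE.
    congr (_ * log2 _).
    by field; rewrite !gt_eqF // subr_gt0.
  apply/eqP; rewrite eq_le; apply/andP; split.
    by apply: varphi_le => //; rewrite sqr_sqrtr ?(ltW rho0) // -DE.
  apply: le_ereal_inf_tmp => _ [U [k1 [k2 [_ kD ->]]]].
  apply: (varphi_feasible_value_ge hsigma kD t0); first exact: dev_lt.
  by rewrite t2 le_eqVlt; apply/orP; left; apply/eqP; rewrite DE; field.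
- move=> D D2.
  (* Correlation 0 makes the output independent of the source, at distortion [2 sigma^2]. *)
  have dev0 : log2 (sigma / channel_dev sigma 0) = 0.
    by rewrite /channel_dev expr0n subr0 sqrtr1 mulr1 divff ?gt_eqF // /log2 ln1 mul0r.
  have leD : sigma ^+ 2 *+ 2 <= D by rewrite -mulr_natl.
  split; apply/eqP; rewrite eq_le; apply/andP; split.
  + by rewrite -[leRHS]/(0%:E) -dev0; apply: phi_le; rewrite // subr0 mulr1.
  + apply: le_ereal_inf_tmp => _ [k kD <-].
    apply: (mutinfo_ge0 (P := source_joint mu sigma k) (X := fst) (Z := snd)).
    by move=> A B mA mB; apply/esym; exact: source_joint_rectangle.
  + rewrite -[leRHS]/(0%:E) -dev0; apply: varphi_le => //.
    by rewrite expr0n subr0 mulr1.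
  + apply: le_ereal_inf_tmp => _ [U [k1 [k2 [_ kD ->]]]].
    rewrite /varphi_value le_max; apply/orP; left.
    apply: (mutinfo_ge0 (P := source_joint mu sigma k1) (X := fst) (Z := snd)).
    by move=> A B mA mB; apply/esym; exact: source_joint_rectangle.
Qed.
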